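(* Under the first-order correlation model, the LoS and NLoS association probabilities of the typical user in the 2D network are $$A_{\mathsf L}=G_{\mathsf L}(0)=2\pi\lambda\int_0^\infty g_{\mathsf L}(x)\,x\,dx,\qquad A_{\mathsf N}=G_{\mathsf N}(0)=2\pi\lambda\int_0^\infty g_{\mathsf N}(x)\,x\,dx,$$ where $$g_{\mathsf L}(x)=p_{\mathsf L}(x)\exp\Big(-\lambda\int_0^{2\pi}\int_0^{x}\frac{p_{\mathsf L,\mathsf L}(x,t,\theta)}{p_{\mathsf L}(x)}t\,dt\,d\theta-\lambda\int_0^{2\pi}\int_0^{e_{\mathsf N|\mathsf L}(x)}\frac{p_{\mathsf L,\mathsf N}(x,t,\theta)}{p_{\mathsf L}(x)}t\,dt\,d\theta\Big),$$ $$g_{\mathsf N}(x)=p_{\mathsf N}(x)\exp\Big(-\lambda\int_0^{2\pi}\int_0^{e_{\mathsf L|\mathsf N}(x)}\frac{p_{\mathsf N,\mathsf L}(x,t,\theta)}{p_{\mathsf N}(x)}t\,dt\,d\theta-\lambda\int_0^{2\pi}\int_0^{x}\frac{p_{\mathsf N,\mathsf N}(x,t,\theta)}{p_{\mathsf N}(x)}t\,dt\,d\theta\Big).$$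
   Context: 2D network. Base stations (BSs) form a homogeneous Poisson point process (PPP) of density $\lambda>0$ on $\mathbb R^2$; the typical user is at the origin. Blockages form an independent Boolean model of line segments: centers form a homogeneous PPP of density $\mu>0$, with i.i.d. random lengths $L$ ($0<\mathbb E[L]<\infty$) and independent orientations uniform on $[0,\pi]$; $\beta=2\mu\mathbb E[L]/\pi$. A link is the segment from the origin to a BS; it is LoS (type $\mathsf L$) if no blockage intersects it and NLoS (type $\mathsf N$) otherwise. A link of length $r$ is LoS with probability $p_{\mathsf L}(r)=e^{-\beta r}$ and NLoS with probability $p_{\mathsf N}(r)=1-e^{-\beta r}$. For two links of lengths $r_1,r_2$ with directions differing by $\theta\in[0,2\pi]$, $p_{s,v}(r_1,r_2,\theta)$ is the probability that the first is of type $s$ and the second of type $v$; thus $p_{\mathsf L,\mathsf L}$ is the probability that no blockage intersects either link, $p_{\mathsf L,\mathsf N}=e^{-\beta r_1}-p_{\mathsf L,\mathsf L}$, $p_{\mathsf N,\mathsf L}=e^{-\beta r_2}-p_{\mathsf L,\mathsf L}$, $p_{\mathsf N,\mathsf N}=1-e^{-\beta r_1}-e^{-\beta r_2}+p_{\mathsf L,\mathsf L}$. Path loss (average received power): $\ell_{\mathsf L},\ell_{\mathsf N}:[0,\infty)\to[0,\infty)$ are bounded and nonincreasing with $\ell_{\mathsf L}\ge\ell_{\mathsf N}$. Exclusion radii: $e_{\mathsf L|\mathsf L}(x)=e_{\mathsf N|\mathsf N}(x)=x$, $e_{\mathsf N|\mathsf L}(x)=\min\{y\ge0:\ell_{\mathsf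 N}(y)\le\ell_{\mathsf L}(x)\}$, $e_{\mathsf L|\mathsf N}(x)=\min\{y\ge0:\ell_{\mathsf L}(y)\le\ell_{\mathsf N}(x)\}$ (min read as infimum, $\infty$ if the set is empty). A BS of type $s$ at distance $x$ is serving iff every other BS of type $v$ is at distance greater than $e_{v|s}(x)$, for $v\in\{\mathsf L,\mathsf N\}$. First-order correlation model: for $r>0$, let $Q_r$ be the law in which there is a given BS at distance $r$, of type $s$ with probability $p_s(r)$; given that it is of type $s$, the other BSs form a PPP of density $\lambda$ and their types are mutually independent, a BS at distance $t$ whose direction makes angle $\theta$ with that of the given BS having type $v$ with probability $p_{s,v}(r,t,\theta)/p_s(r)$. Let $E_{s,r}$ be the event that the given BS is of type $s$ and is serving. In the first-order model the Palm distribution given a BS at distance $r$ is taken to be $Q_r$, so the probability that the serving BS is of type $s$ and at distance greater than $r$ is $G_s(r)=2\pi\lambda\int_r^\infty Q_x[E_{s,x}]\,x\,dx$; $A_s=\mathbb P[E_s]$ is the probability that the user is served by a BS of type $s$. *)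

(* Defs.v *)
From HB Require Import structures.
From mathcomp Require Import all_boot all_order all_algebra.
From mathcomp Require Import all_classical all_reals all_analysis.
Set Implicit Arguments.
Unset Strict Implicit.
Unset Printing Implicit Defensive.
Import Order.TTheory GRing.Theory Num.Theory.
Import numFieldNormedType.Exports.
Local Open Scope classical_set_scope.
Local Open Scope ring_scope.

Definition plane (R : realType) := (measurableTypeR R * measurableTypeR R)%type.

Definition area (R : realType) : set (plane R) -> \bar R :=
  (@lebesgue_measure R \x @lebesgue_measure R)%E.

(* The library's norm on a product is the sup norm, hence this definition. *)
Definition enorm2 (R : realType) (z : plane R) : R :=
  Num.sqrt ((z.1 : R) ^+ 2 + (z.2 : R) ^+ 2).

Definition polar (R : realType) (r theta : R) : plane R :=
  (r * cos theta, r * sin theta).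

(* The direction of z, in [0, 2 pi); the value at the origin is irrelevant. *)
Definition direction (R : realType) (z : plane R) : R :=
  if 0 <= (z.2 : R) then acos ((z.1 : R) / enorm2 z)
  else 2 * pi - acos ((z.1 : R) / enorm2 z).

(* [poisson_pmf] of the library is 1 for every k when the rate is 0; here rate 0
   gives the point mass at 0, as is needed for sets of measure zero. *)
Definition poisson_mass (R : realType) (a : R) (k : nat) : R :=
  a ^+ k / k`!%:R * expR (- a).

(* Point processes on the plane are given by a measurable enumeration of their
   points (a homogeneous process of positive density has infinitely many). *)
Definition npoints (R : realType) (Omega : Type) (X : nat -> Omega -> plane R)
    (A : set (plane R)) (w : Omega) : \bar R :=
  (\sum_(0 <= i <oo) (\1_A (X i w))%:E)%E.

(* Homogeneous Poisson point process of density lam: the numbers of points in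
   disjoint sets of finite area are independent Poisson variables.  The law P is
   a mere set function so that conditional laws can be used. *)
Definition poisson_process (R : realType) (d : measure_display)
    (Omega : measurableType d) (P : set Omega -> \bar R) (lam : R)
    (X : nat -> Omega -> plane R) : Prop :=
  (forall i, measurable_fun setT (X i)) /\
  (forall (n : nat) (A : 'I_n -> set (plane R)) (k : 'I_n -> nat),
    (forall i, measurable (A i)) ->
    (forall i, (area (A i) < +oo)%E) ->
    trivIset setT A ->
    P [set w | forall i, npoints X (A i) w = ((k i)%:R)%:E] =
    (\prod_(i < n) poisson_mass (lam * fine (area (A i))) (k i))%:E).

Definition cond_prob (R : realType) (d : measure_display)
    (Omega : measurableType d) (P : set Omega -> \bar R) (E F : set Omega) :
    \bar R :=
  (((fine (P E))^-1)%:E * P (F `&` E))%E.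

Inductive link_type := LoS | NLoS.

Definition mean_length (R : realType) (nu : probability (measurableTypeR R) R) :
    \bar R :=
  (\int[nu]_(x in setT) (x : R)%:E)%E.

(* Centers C, lengths len with common law nu, orientations phi; the marks are
   i.i.d. and independent of the centers and of each other. *)
Record boolean_model (R : realType) (d : measure_display)
    (Omega : measurableType d) (P : probability Omega R) (mu : R)
    (nu : probability (measurableTypeR R) R)
    (C : nat -> Omega -> plane R) (len phi : nat -> Omega -> measurableTypeR R) :
    Prop := BooleanModel {
  bm_centers : poisson_process P mu C;
  bm_len_meas : forall i, measurable_fun setT (len i);
  bm_phi_meas : forall i, measurable_fun setT (phi i);
  bm_len_nonneg : nu [set x : measurableTypeR R | 0 <= (x : R)] = 1%E;
  bm_len_mean_gt0 : (0 < mean_length nu)%E;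
  bm_len_mean_fin : (mean_length nu < +oo)%E;
  bm_marks : forall (n : nat) (A : 'I_n -> set (plane R))
      (B D : 'I_n -> set (measurableTypeR R)),
    (forall i, measurable (A i)) -> (forall i, measurable (B i)) ->
    (forall i, measurable (D i)) ->
    P [set w | forall i : 'I_n,
         [/\ A i (C i w), B i (len i w) & D i (phi i w)]] =
    (P [set w | forall i : 'I_n, A i (C i w)] *
     \prod_(i < n) (nu (B i) * uniform_prob (pi_gt0 R) (D i)))%E
}.

Definition blockage (R : realType) (c : plane R) (l phi : R) : set (plane R) :=
  [set z | exists2 a : R, `|a| <= l / 2 &
     z = ((c.1 : R) + a * cos phi, (c.2 : R) + a * sin phi) :> plane R].

Definition link (R : realType) (z : plane R) : set (plane R) :=
  [set y | exists2 tau : R, 0 <= tau <= 1 &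
     y = (tau * (z.1 : R), tau * (z.2 : R)) :> plane R].

Definition blocked (R : realType) (Omega : Type)
    (C : nat -> Omega -> plane R) (len phi : nat -> Omega -> measurableTypeR R)
    (z : plane R) (w : Omega) : Prop :=
  exists i, blockage (C i w) (len i w) (phi i w) `&` link z !=set0.

Definition link_has_type (R : realType) (Omega : Type)
    (C : nat -> Omega -> plane R) (len phi : nat -> Omega -> measurableTypeR R)
    (s : link_type) (z : plane R) (w : Omega) : Prop :=
  match s with
  | LoS => ~ blocked C len phi z w
  | NLoS => blocked C len phi z w
  end.

Definition blockage_rate (R : realType) (mu : R)
    (nu : probability (measurableTypeR R) R) : R :=
  2 * mu * fine (mean_length nu) / pi.

Definition link_prob (R : realType) (beta : R) (s : link_type) (r : R) : R :=
  match s with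
  | LoS => expR (- (beta * r))
  | NLoS => 1 - expR (- (beta * r))
  end.

(* The Boolean model is isotropic, so the first link may be taken along the
   first coordinate axis. *)
Definition joint_link_prob (R : realType) (d : measure_display)
    (Omega : measurableType d) (P : probability Omega R)
    (C : nat -> Omega -> plane R) (len phi : nat -> Omega -> measurableTypeR R)
    (s v : link_type) (r1 r2 theta : R) : R :=
  fine (P [set w | link_has_type C len phi s (polar r1 0) w /\
                   link_has_type C len phi v (polar r2 theta) w]).

Record path_loss (R : realType) (ell : link_type -> R -> R) : Prop := PathLoss {
  pl_ge0 : forall s x, 0 <= x -> 0 <= ell s x;
  pl_bounded : forall s, exists M : R, forall x, 0 <= x -> ell s x <= M;
  pl_noninc : forall s x y, 0 <= x -> x <= y -> ell s y <= ell s x;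
  pl_LoS_ge : forall x, 0 <= x -> ell NLoS x <= ell LoS x
}.

(* [excl ell v s x] is e_{v|s}(x). *)
Definition excl (R : realType) (ell : link_type -> R -> R) (v s : link_type)
    (x : R) : \bar R :=
  match v, s with
  | LoS, LoS | NLoS, NLoS => x%:E
  | _, _ => ereal_inf [set y%:E | y in [set y : R | 0 <= y /\ ell v y <= ell s x]]
  end.

(* The family (Q r), r > 0, of laws of the first-order model.  S0 is the type of
   the given BS, which is put at distance r on the first coordinate axis, X and
   T are the positions and types of the other BSs.  [fo_types] says that, given
   S0 = s and X, the types are independent, T i being v with probability
   p2 s v r |X i| (direction (X i)) / p s r. *)
Record first_order_law (R : realType) (d : measure_display)
    (Omega : measurableType d) (lam : R) (p : link_type -> R -> R)
    (p2 : link_type -> link_type -> R -> R -> R -> R)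
    (Q : R -> probability Omega R) (S0 : Omega -> link_type)
    (X : nat -> Omega -> plane R) (T : nat -> Omega -> link_type) : Prop :=
  FirstOrderLaw {
  fo_S0_meas : forall s, measurable [set w | S0 w = s];
  fo_T_meas : forall i v, measurable [set w | T i w = v];
  fo_given : forall (r : R) s, 0 < r -> Q r [set w | S0 w = s] = (p s r)%:E;
  fo_others : forall (r : R) s, 0 < r ->
    poisson_process (cond_prob (Q r) [set w | S0 w = s]) lam X;
  fo_types : forall (r : R) s, 0 < r ->
    forall (n : nat) (v : 'I_n -> link_type) (B : 'I_n -> set (plane R)),
    (forall i, measurable (B i)) ->
    Q r [set w | S0 w = s /\ forall i : 'I_n, T i w = v i /\ B i (X i w)] =
    (\int[Q r]_(w in [set w | S0 w = s])
       (\prod_(i < n) (\1_(B i) (X i w) *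
          (p2 s (v i) r (enorm2 (X i w)) (direction (X i w)) / p s r)))%:E)%E
}.

(* The event E_{s,r} under the law Q r. *)
Definition given_serving (R : realType) (Omega : Type)
    (ell : link_type -> R -> R) (S0 : Omega -> link_type)
    (X : nat -> Omega -> plane R) (T : nat -> Omega -> link_type)
    (s : link_type) (r : R) : set Omega :=
  [set w | S0 w = s /\
     forall i, (excl ell (T i w) s r < (enorm2 (X i w))%:E)%E].

(* [G_serv ... s r] is G_s(r). *)
Definition G_serv (R : realType) (d : measure_display)
    (Omega : measurableType d) (lam : R) (ell : link_type -> R -> R)
    (Q : R -> probability Omega R) (S0 : Omega -> link_type)
    (X : nat -> Omega -> plane R) (T : nat -> Omega -> link_type)
    (s : link_type) (r : R) : \bar R :=
  ((2 * pi * lam)%:E *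
   \int[lebesgue_measure]_(x in `]r, +oo[)
     (Q x (given_serving ell S0 X T s x) * x%:E))%E.

Definition serving (R : realType) (Omega : Type) (ell : link_type -> R -> R)
    (Y : nat -> Omega -> plane R) (U : nat -> Omega -> link_type)
    (s : link_type) (i : nat) : set Omega :=
  [set w | U i w = s /\
     forall j, j <> i ->
       (excl ell (U j w) s (enorm2 (Y i w)) < (enorm2 (Y j w))%:E)%E].

(* E_s: the user is served by a BS of type s. *)
Definition associated (R : realType) (Omega : Type) (ell : link_type -> R -> R)
    (Y : nat -> Omega -> plane R) (U : nat -> Omega -> link_type)
    (s : link_type) : set Omega :=
  \bigcup_i serving ell Y U s i.

(* BSs at the points Y i with types U i. *)
Record bs_process (R : realType) (d : measure_display)
    (Omega : measurableType d) (P : probability Omega R) (lam : R)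
    (Y : nat -> Omega -> plane R) (U : nat -> Omega -> link_type) : Prop :=
  BsProcess {
  bs_poisson : poisson_process P lam Y;
  bs_types_meas : forall i v, measurable [set w | U i w = v]
}.

(* The Palm distribution of the BS process given a BS at distance x is Q x:
   Campbell's formula, the distances having intensity 2 pi lam x dx.  It is
   required only for the event that the given BS has type s and is serving.  No
   typed process satisfies it for all events: conditional independence given the
   type of a singled-out BS would make the joint law of the types of three BSs
   depend on which of them is singled out. *)
Definition first_order_palm (R : realType) (d d' : measure_display)
    (Omega : measurableType d) (P : probability Omega R)
    (Omega' : measurableType d') (lam : R) (ell : link_type -> R -> R)
    (Y : nat -> Omega -> plane R) (U : nat -> Omega -> link_type)
    (Q : R -> probability Omega' R) (S0 : Omega' -> link_type)
    (X : nat -> Omega' -> plane R) (T : nat -> Omega' -> link_type)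
    (s : link_type) : Prop :=
  forall B : set (measurableTypeR R), measurable B -> B `<=` `[0, +oo[ ->
    (\int[P]_(w in setT) \sum_(0 <= i <oo)
       (\1_[set w' | serving ell Y U s i w' /\ B (enorm2 (Y i w'))] w)%:E =
     (2 * pi * lam)%:E *
     \int[lebesgue_measure]_(x in B)
       (Q x (given_serving ell S0 X T s x) * x%:E))%E.

(* Integral over 0 <= theta <= 2 pi and 0 <= t <= e (e possibly infinite). *)
Definition disc_integral (R : realType) (e : \bar R) (f : R -> R -> R) :
    \bar R :=
  (\int[lebesgue_measure]_(theta in `[0%R, (2 * pi)%R])
     \int[lebesgue_measure]_(t in [set t : R | (0 <= t)%R /\ (t%:E <= e)%E])
       (f t theta * t)%:E)%E.

Definition g_LoS (R : realType) (lam : R) (ell : link_type -> R -> R)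
    (p : link_type -> R -> R)
    (p2 : link_type -> link_type -> R -> R -> R -> R) (x : R) : \bar R :=
  ((p LoS x)%:E * expeR
    (- (lam%:E * disc_integral x%:E
          (fun t theta => (p2 LoS LoS x t theta / p LoS x)%R))
     - lam%:E * disc_integral (excl ell NLoS LoS x)
          (fun t theta => (p2 LoS NLoS x t theta / p LoS x)%R)))%E.

Definition g_NLoS (R : realType) (lam : R) (ell : link_type -> R -> R)
    (p : link_type -> R -> R)
    (p2 : link_type -> link_type -> R -> R -> R -> R) (x : R) : \bar R :=
  ((p NLoS x)%:E * expeR
    (- (lam%:E * disc_integral (excl ell LoS NLoS x)
          (fun t theta => (p2 NLoS LoS x t theta / p NLoS x)%R))
     - lam%:E * disc_integral x%:E
          (fun t theta => (p2 NLoS NLoS x t theta / p NLoS x)%R)))%E.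

(* Main.v *)
(* Conditionally on S0 = s, the event E_{s,r} says that no other base station is
   of a type v with distance at most e_{v|s}(r).  Since the types are
   conditionally independent, its probability is the limit of
   E [prod_(i < N) (1 - f (X i))], where f z is the conditional probability that a
   base station at z spoils the event.  The probability generating functional of
   the Poisson process, obtained from step functions f and monotone limits, turns
   this into exp (- lam * int f), and polar coordinates give the two disc
   integrals.  The void probability of the Boolean model is not needed: the sum of
   p_{s,L} and p_{s,N} does not depend on the second link, and the law of the
   types of the first-order model forces it to be p_s(r).
   At most one base station is serving, so that the probability of association is
   the expected number of serving base stations, which is what the Palm formula
   computes. *)

From HB Require Import structures.
Require Import Defs.
From mathcomp Require Import all_boot all_order all_algebra.
From mathcomp Require Import finmap.
From mathcomp Require Import all_classical all_reals all_analysis.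
From mathcomp Require Import measurable_realfun ring lra.
Import Order.TTheory GRing.Theory Num.Theory.
Import numFieldNormedType.Exports.
Local Open Scope classical_set_scope.
Local Open Scope ring_scope.

Set Implicit Arguments.
Unset Strict Implicit.
Unset Printing Implicit Defensive.

Import HBNNSimple.

(** * Polar coordinates *)

(** The enumeration of the stations is arbitrary, so a product over the first N points has no
    explicit expectation; only its limit is determined by the counts. These counts are prescribed
    only on finitely many disjoint sets of finite area. This is why step functions are cut down to
    bounded boxes and why a limit in N has to be exchanged with a limit in the approximation. The
    generating functional applies only to measurable functions of the plane. The function at hand
    contains the probability that a link ending at z is blocked, an event with existential
    quantifiers over real parameters. Its joint measurability in z and the outcome is the aim of the
    part on blockage. Polar coordinates are reached by one-dimensional substitutions and Tonelli's
    theorem alone: integrating along lines through the origin, with the slope written as a tangent,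
    replaces a planar Jacobian. *)

Lemma measurable_funV d (T : measurableType d) (R : realType) (D : set T)
    (f : T -> R) : measurable_fun D f -> measurable_fun D (fun x => (f x)^-1).
Proof.
move=> mf; rewrite (_ : (fun _ => _) = (GRing.inv : R -> R) \o f)//.
apply: measurableT_comp => //.
(* Inversion is not continuous at 0. Writing it as x times the power -1 of x^2 stays correct there,
   since both sides are 0, and uses only measurable functions. *)
rewrite (_ : GRing.inv = (fun x : R => x * (x ^+ 2) `^ (-1))); last first.
  apply/funext => x; rewrite powR_inv1 ?sqr_ge0//.
  have [->|x0] := eqVneq x 0; first by rewrite mul0r invr0.
  by rewrite expr2 invfM mulrA divff// mul1r.
apply: measurable_funM => //.
rewrite (_ : (fun x : R => _) = (fun y => powR y (-1)) \o (fun x => x ^+ 2))//.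
apply: measurableT_comp => //; exact: measurable_powR.
Qed.

(** The right-hand side is a scaled pushforward, hence a measure in [A], and a measure that gives
    half-open intervals their length is Lebesgue measure. *)
Lemma lebesgue_measure_affine (R : realType) (a b : R)
    (A : set (measurableTypeR R)) : a != 0 -> measurable A ->
  lebesgue_measure A = (`|a|%:E * lebesgue_measure
    ((fun x : measurableTypeR R => (a * x + b)%R : measurableTypeR R) @^-1` A))%E.
Proof.
move=> a0 mA.
have mf : measurable_fun setT
    (fun x : measurableTypeR R => (a * x + b : measurableTypeR R)).
  by apply: measurable_funD => //; exact: measurable_funM.
pose m0 : {measure set (measurableTypeR R) -> \bar R} :=
  measure_function_pushforward__canonical__measure_function_Measure
    lebesgue_measure mf.
pose m : {measure set (measurableTypeR R) -> \bar R} :=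
  mscale (NngNum (normr_ge0 a)) m0.
transitivity (m A); last by [].
apply: (@lebesgue_measure_unique R m) => // _ [[c d]] _ <-.
rewrite /m/= /mscale/= /m0/= /pushforward.
have [ap|an] : 0 < a \/ a < 0 by case: (ltgtP a 0) a0 => //; auto.
- rewrite (_ : _ @^-1` _ = `](c - b) / a, (d - b) / a]%classic); last first.
    apply/seteqP; split => x /=; rewrite !in_itv/=.
      by rewrite ltr_pdivrMr// ler_pdivlMr// ltrBlDr lerBrDr (mulrC x).
    by rewrite ltr_pdivrMr// ler_pdivlMr// ltrBlDr lerBrDr (mulrC x).
  rewrite !lebesgue_measure_itv/= !lte_fin.
  rewrite ltr_pM2r ?invr_gt0// ltrD2r; case: ifPn => _; last by rewrite mule0.
  by rewrite gtr0_norm// !EFinN -!EFinB -EFinM; congr (_%:E); field.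
(* A negative slope reverses the interval, so the closed end is now on the left. *)
- rewrite (_ : _ @^-1` _ = `[(d - b) / a, (c - b) / a[%classic); last first.
    apply/seteqP; split => x /=; rewrite !in_itv/=.
      by rewrite ler_ndivrMr// ltr_ndivlMr// ltrBlDr lerBrDr (mulrC x) andbC.
    by rewrite ler_ndivrMr// ltr_ndivlMr// ltrBlDr lerBrDr (mulrC x) andbC.
  rewrite !lebesgue_measure_itv/= !lte_fin.
  rewrite ltr_nM2r ?invr_lt0// ltrD2r; case: ifPn => _; last by rewrite mule0.
  by rewrite ltr0_norm// !EFinN -!EFinB -EFinM; congr (_%:E); field.
Qed.

Lemma ge0_integral_affine (R : realType) (a b : R)
    (f : measurableTypeR R -> \bar R) : a != 0 ->
  measurable_fun setT f -> (forall x, (0 <= f x)%E) ->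
  (\int[lebesgue_measure]_x f x =
   `|a|%:E * \int[lebesgue_measure]_x f (a * x + b)%R)%E.
Proof.
move=> a0 mf f0.
have mg : measurable_fun setT
    (fun x : measurableTypeR R => (a * x + b : measurableTypeR R)).
  by apply: measurable_funD => //; exact: measurable_funM.
pose m0 : {measure set (measurableTypeR R) -> \bar R} :=
  measure_function_pushforward__canonical__measure_function_Measure
    lebesgue_measure mg.
rewrite (eq_measure_integral
    (mscale (NngNum (normr_ge0 a)) m0))/=.
  by rewrite ge0_integral_mscale// ge0_integral_pushforward.
by move=> A mA _; exact: lebesgue_measure_affine.
Qed.

(** Here [mu2] is the image under [phi] of [mu1] with density [w]; the passage from sets to
    functions goes through simple functions and monotone convergence. It serves with [phi] the
    tangent, as a change of variables, and with [phi] the identity, to integrate against a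
    restricted measure. *)
Lemma ge0_integral_density d1 d2 (T1 : measurableType d1)
    (T2 : measurableType d2) (R : realType) (mu1 : {measure set T1 -> \bar R})
    (mu2 : {measure set T2 -> \bar R}) (phi : T1 -> T2) (w : T1 -> R) :
  measurable_fun setT phi -> measurable_fun setT w ->
  (forall x, 0 <= w x) ->
  (forall A, measurable A -> mu2 A = \int[mu1]_(x in phi @^-1` A) (w x)%:E)%E ->
  forall f : T2 -> \bar R, measurable_fun setT f -> (forall y, 0 <= f y)%E ->
  (\int[mu2]_y f y = \int[mu1]_x (f (phi x) * (w x)%:E))%E.
Proof.
move=> mphi mw w0 mu2E f mf f0.
have mw' : measurable_fun setT (EFin \o w) by exact/measurable_EFinP.
pose g := nnsfun_approx measurableT mf.
have mgphi n : measurable_fun setT (fun x => (g n (phi x))%:E).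
  by apply/measurable_EFinP; apply: measurableT_comp.
have ndg x : {homo (fun n => g n x) : m n / (m <= n)%N >-> m <= n}.
  by move=> m n mn; exact/lefP/nd_nnsfun_approx.
transitivity (limn (fun n => \int[mu2]_y (g n y)%:E))%E.
  rewrite -monotone_convergence//.
  - apply: eq_integral => y _; apply/esym/cvg_lim => //.
    by apply: cvg_nnsfun_approx.
  - by move=> n; exact/measurable_EFinP.
  - by move=> n y _; rewrite lee_fin.
  - by move=> y _ m n mn; rewrite lee_fin; exact: ndg.
transitivity (limn (fun n => \int[mu1]_x ((g n (phi x))%:E * (w x)%:E)))%E; last first.
  rewrite -monotone_convergence//.
  - apply: eq_integral => x _; apply/cvg_lim => //.
    apply: cvgeZr => //.
    by apply: cvg_nnsfun_approx.
  - by move=> n; exact: emeasurable_funM.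
  - by move=> n x _; rewrite mule_ge0 ?lee_fin.
  - by move=> x _ m n mn; rewrite lee_wpmul2r ?lee_fin//; exact: ndg.
congr (limn _); apply/funext => n.
under eq_integral do rewrite fimfunE -fsumEFin//.
rewrite ge0_integral_fsum//; last 2 first.
  - by move=> r; exact/measurable_EFinP/measurable_funM.
  - by move=> r y _; rewrite nnfun_muleindic_ge0.
under [RHS]eq_integral.
  move=> x _; rewrite fimfunE -fsumEFin// ge0_mule_fsuml; last first.
    by move=> r; rewrite EFinM nnfun_muleindic_ge0.
  over.
have mi r : measurable_fun setT (fun x => (r * \1_(g n @^-1` [set r]) (phi x))%:E).
  apply/measurable_EFinP/measurable_funM => //.
  by apply: (@measurableT_comp _ _ _ _ _ _ (\1_(g n @^-1` [set r]) : T2 -> R)).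
rewrite [RHS]ge0_integral_fsum//; last 2 first.
  - by move=> r; apply: emeasurable_funM.
  - by move=> r x _; apply: mule_ge0; [rewrite EFinM nnfun_muleindic_ge0|rewrite lee_fin].
apply: eq_fsbigr => r; rewrite inE => -[y _ gy].
rewrite integralZl_indic_nnsfun// integral_indic// setIT mu2E//.
under [RHS]eq_integral do rewrite EFinM -muleA.
rewrite ge0_integralZl//; first last.
  - by rewrite -gy lee_fin.
  - by move=> x _; rewrite mule_ge0 ?lee_fin.
  - apply: emeasurable_funM => //; apply/measurable_EFinP.
    by apply: (@measurableT_comp _ _ _ _ _ _ (\1_(g n @^-1` [set r]) : T2 -> R)).
congr (_ * _)%E; rewrite integral_mkcond; apply: eq_integral => x _.
rewrite patchE indicE.
have -> : (x \in phi @^-1` (g n @^-1` [set r])) = (phi x \in g n @^-1` [set r]).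
  by apply/idP/idP; rewrite !inE.
by case: ifPn => _; rewrite ?mul1e ?mul0e.
Qed.

Lemma measurable_cos (R : realType) (D : set R) : measurable_fun D (@cos R).
Proof.
by apply: measurable_funTS; apply: continuous_measurable_fun; exact: continuous_cos.
Qed.

Lemma measurable_sin (R : realType) (D : set R) : measurable_fun D (@sin R).
Proof.
by apply: measurable_funTS; apply: continuous_measurable_fun; exact: continuous_sin.
Qed.

Lemma measurable_tan (R : realType) (D : set R) : measurable_fun D (@tan R).
Proof.
apply: measurable_funM; first exact: measurable_sin.
by apply: measurable_funV; exact: measurable_cos.
Qed.

(** The derivative of the tangent on its principal branch. Being 0 elsewhere, it removes the other
    branches from integrals over preimages under the periodic function [tan]. *)
Definition sec2_pihalf (R : realType) (x : R) : R :=
  if - (pi / 2) < x < pi / 2 then (cos x)^-2 else 0.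

Lemma sec2_pihalf_ge0 (R : realType) (x : R) : 0 <= sec2_pihalf x.
Proof. by rewrite /sec2_pihalf; case: ifP => // _; rewrite invr_ge0 sqr_ge0. Qed.

Lemma measurable_sec2_pihalf (R : realType) : measurable_fun setT (@sec2_pihalf R).
Proof.
apply: measurable_fun_ifT => //.
- by apply: measurable_and; apply: measurable_fun_ltr.
- apply: measurable_funV; apply: measurable_funX; exact: measurable_cos.
Qed.

(** The integral is a measure in [A], so half-open intervals suffice; for them it is the fundamental
    theorem of calculus with primitive [tan]. *)
Lemma lebesgue_measure_tan (R : realType) (A : set (measurableTypeR R)) : measurable A ->
  lebesgue_measure A =
  (\int[lebesgue_measure]_(x in (@tan R : _ -> measurableTypeR R) @^-1` A) (sec2_pihalf x)%:E)%E.
Proof.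
set I := fun A : set (measurableTypeR R) =>
  (\int[lebesgue_measure]_(x in (@tan R : _ -> measurableTypeR R) @^-1` A) (sec2_pihalf x)%:E)%E.
have mtan (B : set (measurableTypeR R)) : measurable B ->
    measurable ((@tan R : measurableTypeR R -> measurableTypeR R) @^-1` B).
  by move=> mB; rewrite -[X in measurable X]setTI; exact: measurable_tan.
have I0 : I set0 = 0%E by rewrite /I preimage_set0 integral_set0.
have Ige0 B : (0 <= I B)%E by apply: integral_ge0 => x _; rewrite lee_fin; exact: sec2_pihalf_ge0.
have Isa : semi_sigma_additive I.
  move=> F mF tF mUF; rewrite /I preimage_bigcup ge0_integral_bigcup//.
  - apply: is_cvg_ereal_nneg_natsum_cond => n _ _; exact: Ige0.
  - by move=> k; exact: mtan.
  - apply/measurable_EFinP; apply: measurable_funTS; exact: measurable_sec2_pihalf.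
  - by move=> x _; rewrite lee_fin; exact: sec2_pihalf_ge0.
  - apply/trivIsetP => i j _ _ ij; rewrite -preimage_setI.
    by move/trivIsetP : tF => /(_ _ _ Logic.I Logic.I ij) ->; rewrite preimage_set0.
pose m : {measure set (measurableTypeR R) -> \bar R} :=
  HB.pack I (isMeasure.Build _ _ _ I I0 Ige0 Isa).
move=> mA; transitivity (m A); last by [].
apply: (lebesgue_measure_unique (mu := m)) => // _ [[a b]] _ <-.
rewrite /m/= /I lebesgue_measure_itv/= lte_fin.
have atanI (u : R) : atan u \in `](- (pi / 2)), (pi / 2)[.
  by rewrite in_itv/= atan_gtNpi2 atan_ltpi2.
have cos0 (x : R) : - (pi / 2) < x < pi / 2 -> cos x != 0.
  by move=> xI; rewrite gt_eqF// cos_gt0_pihalf.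
(* On the principal branch [tan] is increasing with inverse [atan], so the part of the preimage that
   carries weight is a single interval. *)
have -> : (\int[lebesgue_measure]_(x in (@tan R : _ -> measurableTypeR R) @^-1` `]a, b])
      (sec2_pihalf x)%:E =
    \int[lebesgue_measure]_(x in `]atan a, atan b]) ((cos x)^-2)%:E)%E.
  rewrite integral_mkcond [RHS]integral_mkcond; apply: eq_integral => x _.
  rewrite !patchE /sec2_pihalf.
  have [xI|xI] := boolP (- (pi / 2) < x < pi / 2); last first.
    rewrite (_ : (x \in `]atan a, atan b]%classic) = false) ?if_same//.
    apply/negbTE; apply: contra xI; rewrite inE/= in_itv/= => /andP[ax xb].
    by rewrite (lt_trans (atan_gtNpi2 a) ax) (le_lt_trans xb (atan_ltpi2 b)).
  have xI' : x \in `](- (pi / 2)), (pi / 2)[ by rewrite in_itv.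
  congr (if _ then _ else _); apply/idP/idP; rewrite !inE/= !in_itv/=.
  - rewrite -{1}(atanK a) -{1}(atanK b) ltr_tan// => /andP[-> xb].
    by rewrite leNgt -ltr_tan// -leNgt.
  - move=> /andP[ax]; rewrite leNgt -ltr_tan// -leNgt atanK => ->.
    by rewrite -{1}(atanK a) ltr_tan// ax.
have [ab|ba] := ltP a b; last first.
  rewrite set_itv_ge ?integral_set0// bnd_simp.
  by rewrite -leNgt; exact: le_atan.
have atanI' (x : R) : x \in `[atan a, atan b] -> cos x != 0.
  rewrite in_itv/= => /andP[ax xb]; apply: cos0.
  by rewrite (lt_le_trans (atan_gtNpi2 a) ax) (le_lt_trans xb (atan_ltpi2 b)).
rewrite integral_itv_obnd_cbnd; last first.
  apply/measurable_EFinP/measurable_funV; apply: measurable_funX.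
  exact: measurable_cos.
rewrite (@continuous_FTC2 _ _ (@tan R))//.
- by rewrite !atanK.
- exact: lt_atan.
- apply: continuous_in_subspaceT => x /[1!inE] xab.
  apply: cvgV; first by rewrite expf_neq0// atanI'.
  by apply: (@cvgM _ _ _ _ (@cos R) (@cos R)); exact: continuous_cos.
- split.
  + by move=> x xab; apply: derivable_tan; apply: atanI'; exact: subset_itv_oo_cc.
  + apply: cvg_at_right_filter; apply: continuous_tan; apply: cos0.
    by rewrite atan_gtNpi2 atan_ltpi2.
  + apply: cvg_at_left_filter; apply: continuous_tan; apply: cos0.
    by rewrite atan_gtNpi2 atan_ltpi2.
- move=> x xab; rewrite derive1E; apply: derive_val.
  by apply: is_derive_tan; apply: atanI'; exact: subset_itv_oo_cc.
Qed.

Section polar.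
Context (R : realType).
Local Notation mu := (@lebesgue_measure R).
Local Notation T := (measurableTypeR R).
Local Open Scope ereal_scope.

Let ge0_integral_scale (a : R) (f : T -> \bar R) : (0 < a)%R ->
  measurable_fun setT f -> (forall x, 0 <= f x) ->
  \int[mu]_x f x = a%:E * \int[mu]_x f (a * x)%R.
Proof.
move=> a0 mf f0; rewrite (@ge0_integral_affine R a 0)// ?gt_eqF//.
by rewrite gtr0_norm//; under eq_integral do rewrite addr0.
Qed.

Let polar_itg (F : plane R -> \bar R) (theta : R) :=
  \int[mu]_(t in `]0%R, +oo[) (F (polar t theta) * t%:E).

Let measurable_polar_itg (F : plane R -> \bar R) : measurable_fun setT F ->
  (forall z, 0 <= F z) -> measurable_fun setT (polar_itg F : T -> \bar R).
Proof.
move=> mF F0.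
pose H (z : T * T) := if (0 < z.2)%R then F (polar z.2 z.1) * z.2%:E else 0.
have H0 z : 0 <= H z.
  by rewrite /H; case: ifPn => // z1; rewrite mule_ge0// lee_fin ltW.
have mH : measurable_fun setT H.
  have mcos : measurable_fun setT (fun z : T * T => cos z.1 : T).
    apply: (@measurableT_comp _ _ _ _ _ _ (@cos R : T -> T)) => //.
    exact: measurable_cos.
  have msin : measurable_fun setT (fun z : T * T => sin z.1 : T).
    apply: (@measurableT_comp _ _ _ _ _ _ (@sin R : T -> T)) => //.
    exact: measurable_sin.
  apply: measurable_fun_ifT => //; first by apply: measurable_fun_ltr.
  apply: emeasurable_funM; last exact/measurable_EFinP.
  apply: (@measurableT_comp _ _ _ _ _ _ F) => //.
  by apply: measurable_fun_pair; apply: measurable_funM.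
rewrite (_ : polar_itg F = fun theta => \int[mu]_t H (theta, t)).
  exact: (@measurable_fun_fubini_tonelli_F _ _ T T R mu H).
apply/funext => theta; rewrite /polar_itg integral_mkcond.
apply: eq_integral => t _; rewrite patchE mem_setE in_itv/= andbT /H/=.
by case: ifPn.
Qed.

Let ge0_integral_isometry (a b : R) (D : set T) (f : T -> \bar R) :
  (`|a| = 1)%R -> measurable D -> measurable_fun setT f -> (forall x, 0 <= f x) ->
  \int[mu]_(x in D) f x =
  \int[mu]_(x in (fun x : T => a * x + b : T)%R @^-1` D) f (a * x + b)%R.
Proof.
move=> a1 mD mf f0; rewrite integral_mkcond.
rewrite (@ge0_integral_affine R a b).
- rewrite a1 mul1e [RHS]integral_mkcond; apply: eq_integral => x _.
  by rewrite !patchE.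
- by rewrite -normr_eq0 a1 oner_eq0.
- by apply/(measurable_restrictT _ _).1 => //; exact: measurable_funTS.
- by move=> x; rewrite patchE; case: ifP.
Qed.

(* Substitute x = y * u, then u = tan psi, apply Tonelli's theorem, and substitute
   y = t * cos psi and finally theta = pi / 2 - psi. *)
Lemma ge0_integral_upper_half_plane (F : plane R -> \bar R) :
  measurable_fun setT F -> (forall z, 0 <= F z) ->
  \int[mu]_(y in `]0%R, +oo[) \int[mu]_x F (x, y) =
  \int[mu]_(theta in `]0%R, pi[) polar_itg F theta.
Proof.
move=> mF F0.
have mp (G : T * T -> \bar R) (f g : T -> T) : measurable_fun setT G ->
    measurable_fun setT f -> measurable_fun setT g ->
    measurable_fun setT (fun u => G (f u, g u)).
  by move=> mG mf mg; apply: measurableT_comp => //; exact: measurable_fun_pair.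
transitivity (\int[mu]_(y in `]0%R, +oo[)
    \int[mu]_u (F ((y * u)%R, y) * y%:E)).
  apply: eq_integral => y; rewrite inE/= in_itv/= andbT => y0.
  rewrite (@ge0_integral_scale y)//; last by apply: mp.
  rewrite [RHS]ge0_integralZr//; first by rewrite muleC.
  - by apply: mp => //; exact: measurable_funM.
  - by rewrite lee_fin ltW.
transitivity (\int[mu]_(y in `]0%R, +oo[)
    \int[mu]_psi (F ((y * tan psi)%R, y) * y%:E * (sec2_pihalf psi)%:E)).
  apply: eq_integral => y; rewrite inE/= in_itv/= andbT => y0.
  rewrite (@ge0_integral_density _ _ T T R mu mu (@tan R) (@sec2_pihalf R)) //.
  - exact: measurable_tan.
  - exact: measurable_sec2_pihalf.
  - exact: sec2_pihalf_ge0.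
  - by move=> A mA; exact: lebesgue_measure_tan.
  - apply: emeasurable_funM => //; apply: mp => //; exact: measurable_funM.
  - by move=> u; rewrite mule_ge0// lee_fin ltW.
pose H (z : T * T) := if (0 < z.1)%R then
  F ((z.1 * tan z.2)%R, z.1) * z.1%:E * (sec2_pihalf z.2)%:E else 0.
have H0 z : 0 <= H z.
  rewrite /H; case: ifPn => // z1; apply: mule_ge0; last first.
    by rewrite lee_fin sec2_pihalf_ge0.
  by rewrite mule_ge0// lee_fin ltW.
have mH : measurable_fun setT H.
  have mtan : measurable_fun setT (fun z : T * T => tan z.2 : T).
    apply: (@measurableT_comp _ _ _ _ _ _ (@tan R : T -> T)) => //.
    exact: measurable_tan.
  have msec : measurable_fun setT (fun z : T * T => sec2_pihalf z.2 : T).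
    apply: (@measurableT_comp _ _ _ _ _ _ (@sec2_pihalf R : T -> T)) => //.
    exact: measurable_sec2_pihalf.
  apply: measurable_fun_ifT => //.
  - by apply: measurable_fun_ltr.
  - apply: emeasurable_funM; last exact/measurable_EFinP.
    apply: emeasurable_funM; last by apply/measurable_EFinP.
    apply: (@measurableT_comp _ _ _ _ _ _ F) => //.
    by apply: measurable_fun_pair => //; exact: measurable_funM.
transitivity (\int[mu]_y \int[mu]_psi H (y, psi)).
  rewrite integral_mkcond; apply: eq_integral => y _.
  rewrite patchE mem_setE in_itv/= andbT /H/=.
  by case: ifPn => // _; rewrite integral0.
rewrite (fubini_tonelli H)//.
transitivity (\int[mu]_(psi in `](- (pi / 2))%R, (pi / 2)%R[) polar_itg F (pi / 2 - psi)%R).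
  rewrite [RHS]integral_mkcond; apply: eq_integral => psi _.
  rewrite patchE mem_setE in_itv/=; case: ifPn => psiI; last first.
    by apply: integral0_eq => x _; rewrite /H/= /sec2_pihalf (negbTE psiI) mule0 if_same.
  have c0 : (0 < cos psi)%R by exact: cos_gt0_pihalf.
  rewrite (@ge0_integral_scale (cos psi))//; last first.
    exact: (mp H id (cst psi)).
  rewrite -(ge0_integralZl mu measurableT (f := fun t => H (cos psi * t, psi)%R)).
  + rewrite /polar_itg [RHS]integral_mkcond.
    apply: eq_integral => t _; rewrite patchE mem_setE in_itv/= andbT /H/=.
    rewrite pmulr_rgt0//; case: ifPn => t0; last by rewrite mule0.
    rewrite /sec2_pihalf psiI /polar cosB sinB cos_pihalf sin_pihalf.
    rewrite !mul0r !mul1r add0r subr0 (mulrC (cos psi) t).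
    have -> : (t * cos psi * tan psi = t * sin psi)%R.
      by rewrite /tan; field; rewrite gt_eqF.
    (* The weight t cos psi, the density (cos psi)^-2 and the factor cos psi from scaling y multiply
       to the polar weight t. *)
    rewrite muleC -!muleA; congr (_ * _).
    by rewrite -!EFinM; congr (_%:E); field; rewrite gt_eqF.
  + by apply: (mp H (fun x => cos psi * x)%R (cst psi)) => //; exact: measurable_funM.
  + by [].
  + by rewrite lee_fin ltW.
rewrite [RHS](@ge0_integral_isometry (-1) (pi / 2) `]0%R, pi[ (polar_itg F))//.
- rewrite (_ : (fun x : T => _) @^-1` _ = `](- (pi / 2))%R, (pi / 2)%R[%classic).
    by apply: eq_integral => psi _; rewrite mulN1r addrC.
  apply/seteqP; split => x /=; rewrite !in_itv/= => /andP[? ?];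
    by apply/andP; split; lra.
- by rewrite normrN1.
- exact: measurable_polar_itg.
- move=> x; apply: integral_ge0 => t /=; rewrite in_itv/= andbT => t0.
  by rewrite mule_ge0// lee_fin ltW.
Qed.

(** The lower half-plane is the image of the upper one under z -> -z, which adds pi to the angle.
    The horizontal axis and the angles 0, pi and 2 pi are null sets. *)
Lemma ge0_integral_polar (F : plane R -> \bar R) :
  measurable_fun setT F -> (forall z, 0 <= F z) ->
  \int[mu \x mu]_z F z =
  \int[mu]_(theta in `[0%R, (2 * pi)%R])
    \int[mu]_(t in `]0%R, +oo[) (F (polar t theta) * t%:E).
Proof.
move=> mF F0; rewrite -/(polar_itg F).
pose F' (z : plane R) := F ((- z.1)%R, (- z.2)%R).
have mneg : measurable_fun setT (fun z : plane R => ((- z.1)%R, (- z.2)%R) : plane R).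
  by apply: measurable_fun_pair; apply: measurable_funN.
have mF' : measurable_fun setT F'.
  exact: (@measurableT_comp _ _ _ _ _ _ F).
have F'0 z : 0 <= F' z by exact: F0.
have pF0 G x : (forall z, 0 <= G z) -> 0 <= polar_itg G x.
  move=> G0; apply: integral_ge0 => t /=; rewrite in_itv/= andbT => t0.
  by rewrite mule_ge0// lee_fin ltW.
have mpF := measurable_polar_itg mF F0.
have mG : measurable_fun setT (fun y : T => \int[mu]_x F (x, y)).
  exact: (@measurable_fun_fubini_tonelli_G _ _ T T R mu F).
have G0 y : 0 <= \int[mu]_x F (x, y) by exact: integral_ge0.
rewrite (fubini_tonelli2 F)//.
transitivity (\int[mu]_(theta in `]0%R, pi[) polar_itg F theta +
              \int[mu]_(theta in `]pi, (2 * pi)%R[) polar_itg F theta).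
  have lower : \int[mu]_(y in `]-oo, 0%R[) \int[mu]_x F (x, y) =
      \int[mu]_(theta in `]pi, (2 * pi)%R[) polar_itg F theta.
    transitivity (\int[mu]_(y in `]0%R, +oo[) \int[mu]_x F' (x, y)).
      rewrite (@ge0_integral_isometry (-1) 0)//; last by rewrite normrN1.
      rewrite (_ : (fun x : T => _) @^-1` _ = `]0%R, +oo[%classic).
        apply: eq_integral => y _.
        rewrite (@ge0_integral_affine R (-1) 0)//; last first.
          by apply: (@measurableT_comp _ _ _ _ _ _ F) => //; exact: measurable_fun_pair.
        rewrite normrN1 mul1e; apply: eq_integral => x _.
        by rewrite /F'/= !addr0 !mulN1r.
      by apply/seteqP; split => x /=; rewrite !in_itv/= ?andbT => ?; lra.
    rewrite (ge0_integral_upper_half_plane mF' F'0).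
    rewrite [RHS](@ge0_integral_isometry 1 pi `]pi, (2 * pi)%R[ (polar_itg F))//; last 2 first.
    - by rewrite normr1.
    - by move=> x; exact: pF0.
    rewrite (_ : (fun x : T => _) @^-1` _ = `]0%R, pi[%classic).
      apply: eq_integral => theta _; apply: eq_integral => t _.
      by rewrite /F' /polar/= mul1r cosDpi sinDpi !mulrN.
    apply/seteqP; split => x /=; rewrite !in_itv/= => /andP[? ?];
    by apply/andP; split; lra.
  rewrite -(ge0_integral_upper_half_plane mF F0) -lower addeC.
  rewrite -[in LHS](setvU `]-oo, 0%R[%classic) setUC setCitvl ge0_integral_setU//=.
  - congr (_ + _); rewrite integral_itv_obnd_cbnd//; exact: measurable_funTS.
  - exact: measurable_funTS.
  - by move=> x _; exact: G0.
  - rewrite disj_set2E; apply/eqP; rewrite -subset0 => x [] /=; rewrite !in_itv/= andbT.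
    by rewrite leNgt => ? /negP.
rewrite [RHS]integral_itv_bndoo; last exact: measurable_funTS.
have p0 := pi_gt0 R.
rewrite [in RHS](@itv_bndbnd_setU _ _ _ (BRight pi)); last 2 first.
- exact: pi_ge0.
- by rewrite bnd_simp; lra.
rewrite ge0_integral_setU//=.
- by congr (_ + _); rewrite [RHS]integral_itv_bndoo//; exact: measurable_funTS.
- exact: measurable_funTS.
- by move=> x _; exact: pF0.
- rewrite disj_set2E; apply/eqP; rewrite -subset0 => x [] /=; rewrite !in_itv/=.
  by move=> /andP[_ xp] /andP[px _]; move: (lt_le_trans px xp); rewrite ltxx.
Qed.
End polar.

(** * Measurability of blockage *)

(* The l1 distance between the point of the blockage with parameter sigma in
   [0, 1] and the point of the link with parameter tau in [0, 1]. *)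
Definition segment_gap (R : realType) (c : plane R) (l phi : R) (z : plane R)
    (sigma tau : R) : R :=
  `|(c.1 : R) + (2 * sigma - 1) * (l / 2) * cos phi - tau * (z.1 : R)| +
  `|(c.2 : R) + (2 * sigma - 1) * (l / 2) * sin phi - tau * (z.2 : R)|.

(** Both parameters are normalised to [0, 1] so that they range over a fixed compact square. The
    condition 0 <= l has to be stated separately: for negative l the blockage is empty, yet the gap
    could still vanish. *)
Lemma segments_meetP (R : realType) (c : plane R) (l phi : R) (z : plane R) :
  blockage c l phi `&` link z !=set0 <->
  0 <= l /\ exists st : R * R, [/\ 0 <= st.1 <= 1, 0 <= st.2 <= 1 &
    segment_gap c l phi z st.1 st.2 = 0].
Proof.
rewrite /blockage /link /segment_gap; split.
- move=> [y [/= [a al ya] [tau tau01 yt]]].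
  have l0 : 0 <= l by have := le_trans (normr_ge0 _) al; rewrite pmulr_lge0.
  split=> //; move: ya yt => -> [e1 e2].
  (* A blockage of length 0 is a point, reached for every sigma; otherwise sigma = a / l + 1/2
     solves (2 sigma - 1) l / 2 = a. *)
  have [l00|lneq0] := eqVneq l 0.
    have a0 : a = 0 by apply/eqP; rewrite -normr_le0 (le_trans al)// l00 mul0r.
    exists (0, tau) => /=; split => //; first by rewrite lexx ler01.
    by move: e1 e2; rewrite a0 l00 !mul0r !addr0 => -> ->; rewrite !(mulr0, mul0r, addr0, subrr, normr0).
  have lgt0 : 0 < l by rewrite lt_neqAle eq_sym lneq0.
  exists ((a / l) + 2^-1, tau) => /=; split => //.
    move: al; rewrite ler_norml => /andP[a1 a2].
    rewrite -lerBlDr sub0r -lerBrDr ler_pdivlMr// ler_pdivrMr//.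
    by apply/andP; split; lra.
  rewrite (_ : (2 * _ - 1) * _ = a); last by field.
  by rewrite e1 e2 !subrr !normr0 addr0.
- move=> [l0 [[s t] /= [/andP[s0 s1] t01 /eqP]]].
  rewrite paddr_eq0// !normr_eq0 !subr_eq0 => /andP[/eqP e1 /eqP e2].
  exists (t * (z.1 : R), t * (z.2 : R)); split => /=; last by exists t.
  exists ((2 * s - 1) * (l / 2)); last by rewrite e1 e2.
  by rewrite normrM (ger0_norm (_ : 0 <= l / 2)) ?divr_ge0// ler_piMl ?divr_ge0// ler_norml; apply/andP; split; lra.
Qed.

Lemma continuous_segment_gap (R : realType) (c : plane R) (l phi : R) (z : plane R) :
  continuous (fun st : R * R => segment_gap c l phi z st.1 st.2).
Proof.
move=> st; rewrite /segment_gap.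
have lin (u v w : R) : {for st, continuous (fun st : R * R =>
    `|u + (2 * st.1 - 1) * (l / 2) * v - st.2 * w|)}.
  apply: continuous_comp; last exact: norm_continuous.
  apply: cvgB; last by apply: cvgMl; exact: cvg_snd.
  apply: cvgD; first exact: cvg_cst.
  do 2 apply: cvgMl.
  apply: cvgB; last exact: cvg_cst.
  apply: cvgMr; exact: cvg_fst.
by apply: cvgD; apply: lin.
Qed.

Lemma rat_near_unit (R : realType) (s e : R) : 0 <= s <= 1 -> 0 < e ->
  exists q : rat, (0 <= (ratr q : R) <= 1) /\ `|s - ratr q| < e.
Proof.
move=> /andP[s0 s1] e0.
(* Clipping to ]0, 1[ keeps the approximation admissible even when s is an endpoint. *)
have [|q] := @rat_in_itvoo R (Num.max 0 (s - e)) (Num.min 1 (s + e)).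
  rewrite gt_max !lt_min ltr01/=; apply/andP; split; [|apply/andP; split]; lra.
rewrite in_itv/= gt_max lt_min => /andP[/andP[q0 q1] /andP[q2 q3]].
exists q; split; first by rewrite !ltW.
by rewrite distrC ltr_norml; apply/andP; split; lra.
Qed.

(* By compactness, a zero of the continuous gap is a countable condition on
   rational parameters, hence a measurable one. *)
Lemma segment_gap_eq0P (R : realType) (c : plane R) (l phi : R) (z : plane R) :
  (exists st : R * R, [/\ 0 <= st.1 <= 1, 0 <= st.2 <= 1 &
    segment_gap c l phi z st.1 st.2 = 0]) <->
  (forall n : nat, exists q r : rat, [/\ 0 <= (ratr q : R) <= 1,
    0 <= (ratr r : R) <= 1 &
    segment_gap c l phi z (ratr q) (ratr r) < n.+1%:R^-1]).
Proof.
set f := fun st : R * R => segment_gap c l phi z st.1 st.2.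
have cf : continuous f by exact: continuous_segment_gap.
split.
- move=> [[s t] [/= s01 t01 f0]] n.
  have n0 : 0 < n.+1%:R^-1 :> R by rewrite invr_gt0.
  have := cf (s, t) => /cvgrPdist_lt /(_ _ n0).
  move=> -[[U V]/= [/nbhs_ballP[d1 /= d10 d1U] /nbhs_ballP[d2 /= d20 d2V]] UV].
  have [q [q01 sq]] := rat_near_unit s01 d10.
  have [r [r01 tr]] := rat_near_unit t01 d20.
  exists q, r; split => //.
  have := UV (ratr q, ratr r); rewrite /f/= f0 sub0r normrN => h.
  apply: le_lt_trans (h _); first exact: ler_norm.
  by split; [exact: d1U|exact: d2V].
- move=> h.
  pose K : set (R * R) := `[0, 1] `*` `[0, 1].
  have K0 : K !=set0 by exists (0, 0); split; rewrite /= in_itv/= lexx ler01.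
  have cK : compact K by apply: compact_setX; exact: segment_compact.
  have [st] := compact_EVT_min K0 cK (continuous_subspaceT cf).
  rewrite inE => -[/=]; rewrite !in_itv/= => s01 t01 fmin.
  exists st; split => //; apply/eqP; rewrite eq_le; apply/andP; split; last first.
    by rewrite addr_ge0.
  apply/ler_addgt0Pl => e e0; rewrite addr0.
  have [n ne] : exists n : nat, n.+1%:R^-1 < e.
    by exists (Num.truncn e^-1); rewrite invf_plt ?posrE// truncnS_gt.
  have [q [r [q01 r01 /ltW qr]]] := h n.
  apply: (le_trans _ (ltW ne)); apply: le_trans qr.
  apply: (fmin (ratr q, ratr r)); rewrite inE; split => /=; by rewrite in_itv.
Qed.

(** The far end [z] also varies with the point of [T], since [T] will be the product of the plane
    and the sample space. *)
Lemma measurable_segments_meet d (T : measurableType d) (R : realType)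
    (c z : T -> plane R) (l phi : T -> measurableTypeR R) :
  measurable_fun setT c -> measurable_fun setT z ->
  measurable_fun setT l -> measurable_fun setT phi ->
  measurable [set x | blockage (c x) (l x) (phi x) `&` link (z x) !=set0].
Proof.
move=> mc mz ml mphi.
have /measurable_fun_pairP[mc1 mc2] := mc.
have /measurable_fun_pairP[mz1 mz2] := mz.
have mcos : measurable_fun setT (fun x => cos (phi x : R)).
  by apply: (@measurableT_comp _ _ _ _ _ _ (@cos R)) => //; exact: measurable_cos.
have msin : measurable_fun setT (fun x => sin (phi x : R)).
  by apply: (@measurableT_comp _ _ _ _ _ _ (@sin R)) => //; exact: measurable_sin.
have mgap s t : measurable_fun setT (fun x => segment_gap (c x) (l x) (phi x) (z x) s t).
  have lin (u v w : T -> R) : measurable_fun setT u -> measurable_fun setT v ->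
      measurable_fun setT w ->
      measurable_fun setT (fun x => `|u x + (2 * s - 1) * (l x / 2) * v x - t * w x|).
    move=> mu mv mw; apply: (@measurableT_comp _ _ _ _ _ _ (Num.norm : R -> R)) => //.
    apply: measurable_funB; last exact: measurable_funM.
    apply: measurable_funD => //; apply: measurable_funM => //.
    by apply: measurable_funM => //; exact: measurable_funM.
  by apply: measurable_funD; apply: lin.
rewrite (_ : [set x | _] = [set x | 0 <= (l x : R)] `&` \bigcap_(n in [set: nat])
    \bigcup_(q in [set: rat]) \bigcup_(r in [set: rat])
    ([set x | (0 <= (ratr q : R) <= 1) && (0 <= (ratr r : R) <= 1)] `&`
     [set x | segment_gap (c x) (l x) (phi x) (z x) (ratr q) (ratr r) < n.+1%:R^-1])).
  apply: measurableI.
    rewrite -[X in measurable X]setTI; apply: (measurable_fun_ler (f := cst 0)) => //.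
  apply: bigcapT_measurable => n; apply: bigcupT_measurable_rat => q.
  apply: bigcupT_measurable_rat => r; apply: measurableI.
    case: (_ && _).
      by rewrite (_ : [set _ | _] = setT)//; apply/seteqP; split.
    by rewrite (_ : [set _ | _] = set0)//; apply/seteqP; split.
  rewrite -[X in measurable X]setTI.
  exact: (measurable_fun_ltr (g := cst n.+1%:R^-1)).
apply/seteqP; split => x /=.
- move=> /segments_meetP[l0 /segment_gap_eq0P h]; split=> // n _.
  by have [q [r [q01 r01 qr]]] := h n; exists q => //; exists r => //; split => //=; rewrite q01 r01.
- move=> [l0 h]; apply/segments_meetP; split => //; apply/segment_gap_eq0P => n.
  by have [q _ [r _ /= [/andP[q01 r01] qr]]] := h n I; exists q, r; split.
Qed.

(** * The generating functional of a Poisson process *)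

Section independent_counts.
Context d (Om : measurableType d) (R : realType).
Variables (m : {measure set Om -> \bar R}) (n : nat).
Variables (E : 'I_n -> nat -> set Om) (p : 'I_n -> nat -> R).
Hypothesis mE : forall j k, measurable (E j k).
Hypothesis indepE : forall k : 'I_n -> nat,
  m (\big[setI/setT]_j E j (k j)) = (\prod_j p j (k j))%:E.

(** When [E j k] says that the j-th count is k, [W j] is a function of that count, and this is the
    product rule for expectations of independent variables, derived from the product rule for the
    events alone. *)
Lemma integral_prod_series (a : 'I_n -> nat -> R) (W : 'I_n -> Om -> R)
    (Z : 'I_n -> R) :
  (forall j k, 0 <= a j k) ->
  (forall j w, \sum_(0 <= k <oo) (a j k * \1_(E j k) w)%:E = (W j w)%:E)%E ->
  (forall j, \sum_(0 <= k <oo) (a j k * p j k)%:E = (Z j)%:E)%E ->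
  (forall j k, 0 <= p j k) ->
  (\int[m]_w (\prod_j W j w)%:E = (\prod_j Z j)%:E)%E.
Proof.
move=> a0 aW aZ p0.
have mW j : measurable_fun setT (W j).
  apply/measurable_EFinP.
  rewrite (_ : EFin \o W j = fun w => (\sum_(0 <= k <oo) (a j k * \1_(E j k) w)%:E)%E).
    apply: ge0_emeasurable_sum => k; first by move=> w _ _; rewrite lee_fin mulr_ge0.
    by move=> _; apply/measurable_EFinP; exact: measurable_funM.
  by apply/funext => w; rewrite aW.
have W0 j w : 0 <= W j w.
  by rewrite -lee_fin -aW; apply: nneseries_ge0 => k _ _; rewrite lee_fin mulr_ge0.
(* The indicators are replaced by their series one index at a time. *)
suff H : forall (i : nat) (k : 'I_n -> nat), (i <= n)%N ->
    (\int[m]_w (\prod_(j < n) (if (j < i)%N then W j w else \1_(E j (k j)) w))%:E =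
     (\prod_(j < n) (if (j < i)%N then Z j else p j (k j)))%:E)%E.
  rewrite (eq_bigr (fun j : 'I_n => if (j < n)%N then Z j else p j 0%N)); last first.
    by move=> j _; rewrite ltn_ord.
  rewrite -(H n (fun=> 0%N) (leqnn _)); apply: eq_integral => w _; congr EFin.
  by apply: eq_bigr => j _; rewrite ltn_ord.
elim=> [k _|i IH k ilt].
  rewrite -indepE -[in RHS](setIT (\big[setI/setT]_j _)) -integral_indic//; last first.
    exact: bigsetI_measurable.
  apply: eq_integral => w _; congr (_%:E).
  have {}IH : forall s : seq 'I_n, \prod_(j <- s) (\1_(E j (k j)) w : R) =
      \1_(\big[setI/setT]_(j <- s) E j (k j)) w.
    elim=> [|j s IH]; first by rewrite !big_nil indicT.
    by rewrite !big_cons IH indicI.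
  exact: IH.
pose j0 := Ordinal ilt.
have neq_lt (j : 'I_n) : j != j0 -> (j < i.+1)%N = (j < i)%N.
  by rewrite -val_eqE /= => ji; rewrite ltnS leq_eqVlt (negbTE ji).
(* Varying the value at [j0] gives every term of the series for [W j0], and the induction hypothesis
   applies to each. *)
pose k' l (j : 'I_n) := if j == j0 then l else k j.
pose P w := \prod_(j < n | j != j0) (if (j < i)%N then W j w else \1_(E j (k j)) w).
have P0 w : 0 <= P w by apply: prodr_ge0 => j _; case: ifP.
have mP : measurable_fun setT P.
  rewrite (_ : P = fun w => \prod_(j < n) (if j != j0 then
      (if (j < i)%N then W j w else \1_(E j (k j)) w) else 1)); last first.
    by apply/funext => w; rewrite /P big_mkcond.
  apply: measurable_prod => j _; case: (j != j0); last exact: measurable_cst.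
  by case: (j < i)%N => //; exact: measurable_indic.
have Pk' l w : \prod_(j < n) (if (j < i)%N then W j w else \1_(E j (k' l j)) w) =
    \1_(E j0 l) w * P w.
  rewrite (bigD1 j0)//= ltnn /k' eqxx; congr (_ * _).
  by apply: eq_bigr => j /negbTE jj; rewrite jj.
have IHl l : (\int[m]_w (\1_(E j0 l) w * P w)%:E =
    (p j0 l * \prod_(j < n | j != j0) (if (j < i)%N then Z j else p j (k j)))%:E)%E.
  under eq_integral do rewrite -Pk'.
  rewrite IH ?(ltnW ilt)//; congr (_%:E).
  rewrite (bigD1 j0)//= ltnn /k' eqxx; congr (_ * _).
  by apply: eq_bigr => j /negbTE jj; rewrite jj.
transitivity (\int[m]_w (\sum_(0 <= l <oo) (a j0 l * (\1_(E j0 l) w * P w))%:E))%E.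
  apply: eq_integral => w _.
  rewrite (bigD1 j0)//= leqnn.
  rewrite (_ : \prod_(_ < n | _) _ = P w); last first.
    by apply: eq_bigr => j jj; rewrite neq_lt.
  rewrite EFinM muleC -aW -nneseriesZl; last by move=> l _; rewrite lee_fin mulr_ge0.
  by apply: eq_eseriesr => l _; rewrite -EFinM mulrC mulrA.
rewrite integral_nneseries//; last 2 first.
- move=> l; apply/measurable_EFinP; apply: measurable_funM => //.
  by apply: measurable_funM.
- by move=> l w _; rewrite lee_fin !mulr_ge0.
rewrite [in RHS](bigD1 j0)//= leqnn.
under [in RHS]eq_bigr => j jj do rewrite neq_lt//.
set Q := \prod_(_ < n | _) _ in IHl *.
rewrite EFinM -aZ muleC -nneseriesZl; last by move=> l _; rewrite lee_fin mulr_ge0.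
apply: eq_eseriesr => l _; under eq_integral do rewrite EFinM.
rewrite ge0_integralZl//; last 3 first.
- by apply/measurable_EFinP; apply: measurable_funM.
- by move=> w _; rewrite lee_fin mulr_ge0.
- by rewrite lee_fin.
by rewrite IHl -!EFinM; congr (_%:E); ring.
Qed.

End independent_counts.

Lemma poisson_mass_ge0 (R : realType) (a : R) k : 0 <= a -> 0 <= poisson_mass a k.
Proof. by move=> a0; rewrite /poisson_mass mulr_ge0 ?expR_ge0// divr_ge0 ?exprn_ge0. Qed.

(** The generating function of the Poisson law, from the exponential series. At c = 1 it gives total
    mass 1; at c = 1 - s it gives the factor contributed by a set on which the step function equals
    s. *)
Lemma poisson_mass_generating (R : realType) (a c : R) :
  (\sum_(0 <= k <oo) (c ^+ k * poisson_mass a k)%:E = (expR (- (a * (1 - c))))%:E)%E.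
Proof.
have h : series (exp_coeff (c * a)) n @[n --> \oo] --> expR (c * a).
  exact: is_cvg_series_exp_coeff.
have {}h : (expR (- a) * series (exp_coeff (c * a)) n)%:E @[n --> \oo] -->
    (expR (- a) * expR (c * a))%:E.
  by apply: cvg_EFin; [near=> n|apply: cvgMr].
apply/cvg_lim => //; move: h.
rewrite -expRD (_ : - a + c * a = - (a * (1 - c))); last by ring.
apply: cvg_trans; apply: near_eq_cvg; near=> n.
rewrite /= sumEFin /series/= mulr_sumr; congr (_%:E); apply: eq_bigr => k _.
by rewrite /exp_coeff/= /poisson_mass exprMn; ring.
Unshelve. all: by end_near. Qed.

Section poisson_functional.
Context d (Om : measurableType d) (R : realType).
Variables (m : {measure set Om -> \bar R}) (lam : R) (X : nat -> Om -> plane R).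
Hypotheses (lam0 : 0 < lam) (pX : poisson_process m lam X).

Let mX i : measurable_fun setT (X i). Proof. exact: pX.1. Qed.

(** The empty family of sets imposes no condition on the outcome, and the empty product is 1. *)
Lemma poisson_process_measT : m setT = 1%E.
Proof.
have := pX.2 0%N (fun=> set0) (fun=> 0%N).
rewrite big_ord0 (_ : [set w | _] = setT); last first.
  by apply/seteqP; split => // w _ [].
by apply; [case|case|move=> [] ? []].
Qed.

Lemma measurable_npoints (A : set (plane R)) : measurable A ->
  measurable_fun setT (npoints X A).
Proof.
move=> mA; apply: ge0_emeasurable_sum => [k w _ _|k _]; first by rewrite lee_fin.
apply/measurable_EFinP.
by apply: (@measurableT_comp _ _ _ _ _ _ (\1_A : plane R -> R)) => //; exact: mX.
Qed.

Lemma measurable_npoints_eq (A : set (plane R)) (k : nat) : measurable A ->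
  measurable [set w | npoints X A w = k%:R%:E].
Proof.
move=> mA; rewrite -[X in measurable X]setTI.
exact: (measurable_npoints mA measurableT (emeasurable_set1 _)).
Qed.

(** The partial counts are integers converging to k, and an integer at distance less than 1 from k
    equals k. *)
Lemma npoints_eq_near (A : set (plane R)) (k : nat) (w : Om) :
  npoints X A w = k%:R%:E ->
  \forall N \near \oo, (\sum_(i < N) (X i w \in A))%N = k.
Proof.
move=> XA.
have : (\sum_(0 <= i < N) (\1_A (X i w))%:E)%E @[N --> \oo] --> (k%:R%:E : \bar R).
  rewrite -XA; apply: is_cvg_nneseries => i _ _; by rewrite lee_fin.
move=> /fine_cvgP[_] /cvgrPdist_lt /(_ 1 ltr01).
apply: filterS => N /=; rewrite sumEFin/= big_mkord.
rewrite (_ : \sum_(i < N) \1_A (X i w) = (\sum_(i < N) (X i w \in A))%N%:R :> R); last first.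
  by rewrite natr_sum; apply: eq_bigr => i _; rewrite indicE.
rewrite distrC.
set s := (\sum_(i < N) _)%N => sk; apply/eqP; move: sk.
rewrite eqn_leq leqNgt [(k <= s)%N]leqNgt -negb_or; apply: contraL.
rewrite -leNgt => /orP[ks|sk].
- by rewrite ger0_norm ?subr_ge0 ?ler_nat ?(ltnW ks)// lerBrDr nat1r ler_nat.
- by rewrite distrC ger0_norm ?subr_ge0 ?ler_nat ?(ltnW sk)// lerBrDr nat1r ler_nat.
Qed.

Let trivIset_npoints_eq (A : set (plane R)) :
  trivIset setT (fun k : nat => [set w | npoints X A w = k%:R%:E]).
Proof.
apply/trivIsetP => i j _ _ /eqP ij; apply/seteqP; split => // w [/= -> [/eqP]].
by rewrite eqr_nat => /eqP.
Qed.

(** A count could be infinite a priori; but the Poisson masses sum to 1, the total mass of [m], and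
    leave nothing for that event. *)
Lemma npoints_natP (A : set (plane R)) : measurable A -> (area A < +oo)%E ->
  {ae m, forall w, exists k : nat, npoints X A w = k%:R%:E}.
Proof.
move=> mA fA.
pose E k := [set w | npoints X A w = k%:R%:E].
have mE k : measurable (E k) by exact: measurable_npoints_eq.
have mUE : measurable (\bigcup_k E k) by exact: bigcup_measurable.
have UE : m (\bigcup_k E k) = 1%E.
  rewrite measure_bigcup//; last exact: trivIset_npoints_eq.
  transitivity (\sum_(0 <= k <oo) (1 ^+ k * poisson_mass (lam * fine (area A)) k)%:E)%E.
    rewrite (eq_eseriesl (Q := xpredT)); last by move=> k; rewrite in_setT.
    apply: eq_eseriesr => k _; rewrite expr1n mul1r.
    have := pX.2 1%N (fun=> A) (fun=> k); rewrite big_ord1 => <- //.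
    - by congr (m _); apply/seteqP; split => w /= h; [move=> _; exact: h|exact: (h ord0)].
    - by move=> i j _ _ _; rewrite !ord1.
  by rewrite poisson_mass_generating subrr mulr0 oppr0 expR0.
have UC : m (~` \bigcup_k E k) = 0%E.
  have : (m (\bigcup_k E k) + m (~` \bigcup_k E k) = 1)%E.
    rewrite -measureU ?setUv ?setICr//; last exact: measurableC.
    exact: poisson_process_measT.
  rewrite UE; case: (m (~` _)) => [r| |]//; rewrite -EFinD => -[h].
  by congr (_%:E); lra.
have : m.-negligible (~` \bigcup_k E k).
  by apply/negligibleP => //; exact: measurableC.
by apply: negligibleS => w /= + [k _ Ek]; apply; exists k.
Qed.

Let mprodX (f : plane R -> R) N : measurable_fun setT f ->
  measurable_fun setT (fun w => (\prod_(i < N) (1 - f (X i w)))%:E).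
Proof.
move=> mf; apply/measurable_EFinP; apply: measurable_prod => i _.
apply: measurable_funB => //.
by apply: (@measurableT_comp _ _ _ _ _ _ f) => //; exact: mX.
Qed.

Let integrable1 : m.-integrable setT (cst 1%E).
Proof.
apply/integrableP; split=> //; under eq_integral do rewrite abse1.
by rewrite integral_cst// mul1e poisson_process_measT ltry.
Qed.

Let prodX01 (f : plane R -> R) N w : (forall z, 0 <= f z <= 1) ->
  0 <= \prod_(i < N) (1 - f (X i w)) <= 1.
Proof.
move=> f01; apply/andP; split.
  by apply: prodr_ge0 => i _; have /andP[] := f01 (X i w); rewrite subr_ge0.
apply: prodr_ile1 => i _; have /andP[] := f01 (X i w) => ? ?.
by by rewrite subr_ge0 gerBl; apply/andP.
Qed.

(** Almost surely all points of the sets [A j] have been listed from some N on. The product is then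
    constant, equal to the product over j of 1 - [s j] to the power of the count in [A j]. Dominated
    convergence, with bound 1, and independence of the counts conclude. *)
Lemma poisson_functional_simple (n : nat) (A : 'I_n -> set (plane R))
    (s : 'I_n -> R) :
  (forall j, measurable (A j)) -> (forall j, (area (A j) < +oo)%E) ->
  trivIset setT A -> (forall j, 0 <= s j <= 1) ->
  (\int[m]_w (\prod_(i < N) (1 - \sum_j s j * \1_(A j) (X i w)))%:E)%E
    @[N --> \oo] -->
  (\prod_j expR (- (lam * fine (area (A j)) * s j)))%:E.
Proof.
move=> mA fA tA s01.
pose E j k := [set w | npoints X (A j) w = k%:R%:E].
pose c j := 1 - s j.
have c0 j : 0 <= c j by rewrite subr_ge0; have /andP[] := s01 j.
have mE j k : measurable (E j k) by exact: measurable_npoints_eq.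
pose p j := poisson_mass (lam * fine (area (A j))).
have p0 j k : 0 <= p j k.
  by apply: poisson_mass_ge0; rewrite mulr_ge0 ?(ltW lam0)// fine_ge0.
have indepE (k : 'I_n -> nat) :
    m (\big[setI/setT]_j E j (k j)) = (\prod_j p j (k j))%:E.
  rewrite -(pX.2 n A k)//; congr (m _).
  rewrite -bigcap_seq; apply/seteqP; split => w /= h j.
    by apply: (h j); rewrite /= mem_index_enum.
  by move=> _; exact: h.
(* This is [c j] to the power of the count in [A j]. If the count is infinite, every indicator
   vanishes and the value is 0, so the series identity holds everywhere, not only almost surely. *)
pose W j w := fine (\sum_(0 <= k <oo) (c j ^+ k * \1_(E j k) w)%:E)%E.
have WE j w k : E j k w ->
    (\sum_(0 <= k <oo) (c j ^+ k * \1_(E j k) w)%:E = (c j ^+ k)%:E)%E.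
  move=> Ek; rewrite (@nneseriesD1 _ _ k)//; last first.
    by move=> l _; rewrite lee_fin mulr_ge0// exprn_ge0.
  rewrite indicE mem_set// mulr1 eseries0 ?adde0// => l _ /= lk.
  rewrite indicE memNset ?mulr0// => El; move: lk; rewrite /E/= in El Ek.
  move: El; rewrite Ek => -[/eqP]; rewrite eqr_nat eq_sym => ->.
  by [].
have WE' j w : (\sum_(0 <= k <oo) (c j ^+ k * \1_(E j k) w)%:E = (W j w)%:E)%E.
  rewrite /W; have [[k Ek]|nE] := pselect (exists k, E j k w).
    by rewrite (WE _ _ _ Ek).
  rewrite eseries0// => k _ _; rewrite indicE memNset ?mulr0// => Ek.
  by apply: nE; exists k.
have ZE j : (\sum_(0 <= k <oo) (c j ^+ k * p j k)%:E =
    (expR (- (lam * fine (area (A j)) * s j)))%:E)%E.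
  by rewrite poisson_mass_generating /c subKr.
have intW := integral_prod_series mE indepE
  (fun j k => exprn_ge0 k (c0 j)) WE' ZE p0.
rewrite -intW.
set phi := fun z => \sum_j s j * \1_(A j) z.
(* The sets are disjoint, so at most one term of the sum and one factor of the product are
   nontrivial. *)
have phiE z : 1 - phi z = \prod_j c j ^+ (z \in A j).
  have [[j0 zj0]|nA] := pselect (exists j, A j z); last first.
    rewrite /phi !big1 ?subr0// => j _.
      by rewrite memNset// => zj; apply: nA; exists j.
    by rewrite indicE memNset ?mulr0// => zj; apply: nA; exists j.
  have nj j : j != j0 -> (z \in A j) = false.
    move=> jj0; apply/negbTE; rewrite notin_setE => zj.
    move/trivIsetP : tA => /(_ j j0 Logic.I Logic.I jj0) /seteqP[/(_ z) + _].
    by apply.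
  rewrite /phi (bigD1 j0)//= [in RHS](bigD1 j0)//= !big1 ?addr0 ?mulr1; last 2 first.
  - by move=> j jj0; rewrite nj.
  - by move=> j jj0; rewrite indicE nj// mulr0.
  by rewrite indicE mem_set// mulr1.
have phi01 z : 0 <= phi z <= 1.
  have : 0 <= 1 - phi z <= 1.
    rewrite phiE; apply/andP; split.
      by apply: prodr_ge0 => j _; rewrite exprn_ge0.
    apply: prodr_ile1 => j _; rewrite exprn_ge0//= exprn_ile1//.
    by rewrite gerBl; have /andP[] := s01 j.
  by move=> /andP[? ?]; apply/andP; split; lra.
have mphi : measurable_fun setT phi.
  by apply: measurable_sum => j; apply: measurable_funM => //; exact: measurable_indic.
have [] // := @dominated_convergence _ _ _ m setT measurableT
  (fun N w => (\prod_(i < N) (1 - phi (X i w)))%:E)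
  (fun w => (\prod_j W j w)%:E) (cst 1%E).
- by move=> N; exact: mprodX.
- apply/measurable_EFinP; apply: measurable_prod => j _; apply/measurable_EFinP.
  rewrite (_ : EFin \o W j = fun w => (\sum_(0 <= k <oo) (c j ^+ k * \1_(E j k) w)%:E)%E).
    apply: ge0_emeasurable_sum => k.
      by move=> w _ _; rewrite lee_fin mulr_ge0// exprn_ge0.
    by move=> _; apply/measurable_EFinP; apply: measurable_funM.
  by apply/funext => w; rewrite WE'.
- have : {ae m, forall w (j : 'I_n), exists k : nat, npoints X (A j) w = k%:R%:E}.
    by apply: filter_forall => j; exact: npoints_natP.
  apply: filterS => w /choice[k Ek] _.
  apply: cvg_near_cst.
  have : \forall N \near \oo, forall j, (\sum_(i < N) (X i w \in A j))%N = k j.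
    by apply: filter_forall => j; exact: npoints_eq_near.
  apply: filterS => N hN; congr (_%:E).
  transitivity (\prod_(i < N) \prod_j c j ^+ (X i w \in A j)).
    by apply: eq_bigr => i _; rewrite -phiE.
  rewrite exchange_big/=; apply: eq_bigr => j _.
  by rewrite -expr_sum hN /W (WE _ _ (k j))//= Ek.
- apply: aeW => w N _; rewrite lee_fin ger0_norm.
  + by have /andP[] := prodX01 N w phi01.
  + by have /andP[] := prodX01 N w phi01.
Qed.

Local Notation mu2 := (@lebesgue_measure R \x @lebesgue_measure R)%E.

(** A simple function on the plane has a level set of infinite area; intersecting with [D] brings
    all level sets within reach of the counting law. *)
Let poisson_functional_nnsfun (g : {nnsfun (plane R) >-> R}) (D : set (plane R)) :
  measurable D -> (area D < +oo)%E -> (forall z, g z <= 1) ->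
  (\int[m]_w (\prod_(i < N) (1 - g (X i w) * \1_D (X i w)))%:E)%E
    @[N --> \oo] -->
  expeR (- (lam%:E * \int[mu2]_z (g z * \1_D z)%:E))%E.
Proof.
move=> mD fD g1.
pose s := fset_set (range g).
pose A (j : 'I_#|`s|) := g @^-1` [set s`_j] `&` D.
have sE (j : 'I_#|`s|) : exists z, g z = s`_j.
  have : s`_j \in s by apply: mem_nth.
  by rewrite in_fset_set// inE/= => -[z _ gz]; exists z.
have s01 (j : 'I_#|`s|) : 0 <= s`_j <= 1.
  by have [z <-] := sE j; rewrite g1 andbT.
have mA j : measurable (A j) by apply: measurableI.
have fA j : (area (A j) < +oo)%E.
  apply: le_lt_trans fD; apply: (@le_measure _ _ _ mu2); rewrite ?inE//.
  exact: subIsetr.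
have tA : trivIset setT A.
  apply/trivIsetP => i j _ _ ij; apply/seteqP; split => // z [[/= gi _] [/= gj _]].
  move: ij; rewrite -val_eqE/= => /negP; apply; rewrite -(nth_uniq 0 (ltn_ord i) (ltn_ord j) (fset_uniq s)).
  by rewrite -gi -gj.
have gE z : g z * \1_D z = \sum_(j < #|`s|) s`_j * \1_(A j) z.
  rewrite {1}fimfunEord mulr_suml; apply: eq_bigr => j _.
  by rewrite /A indicI/= mulrA.
have -> : (expeR (- (lam%:E * \int[mu2]_z (g z * \1_D z)%:E)) =
   (\prod_(j < #|`s|) expR (- (lam * fine (area (A j)) * s`_j)))%:E)%E.
  have -> : (\int[mu2]_z (g z * \1_D z)%:E =
      (\sum_(j < #|`s|) s`_j * fine (area (A j)))%:E)%E.
    under eq_integral do rewrite gE -sumEFin.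
    rewrite ge0_integral_sum//; last 2 first.
    - by move=> j; apply/measurable_EFinP; apply: measurable_funM => //; exact: measurable_indic.
    - by move=> j z _; rewrite lee_fin mulr_ge0//; have /andP[] := s01 j.
    rewrite -sumEFin; apply: eq_bigr => j _.
    under eq_integral do rewrite EFinM.
    rewrite ge0_integralZl//; last 2 first.
    - by apply/measurable_EFinP; exact: measurable_indic.
    - by rewrite lee_fin; have /andP[] := s01 j.
    rewrite integral_indic// setIT EFinM; congr (_ * _)%E.
    rewrite fineK// ge0_fin_numE//; exact: fA.
  rewrite -EFinM -EFinN /= -expR_sum; congr (expR _)%:E.
  rewrite mulr_sumr -sumrN; apply: eq_bigr => j _.
  by rewrite mulrA mulrAC.
have := poisson_functional_simple mA fA tA s01.
apply: cvg_trans; apply: near_eq_cvg; near=> N.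
apply: eq_integral => w _; congr (_%:E); apply: eq_bigr => i _.
by rewrite gE.
Unshelve. all: by end_near. Qed.

Let box k : set (plane R) := `[- k%:R, k%:R] `*` `[- k%:R, k%:R].

Let mbox k : measurable (box k). Proof. exact: measurableX. Qed.

Let area_box k : (area (box k) < +oo)%E.
Proof.
rewrite /area product_measure1E// lte_mul_pinfty//.
- by rewrite ge0_fin_numE//= lebesgue_measure_itv/=; case: ifP => _; rewrite ?ltry// -EFinB ltry.
- by rewrite /= lebesgue_measure_itv/=; case: ifP => _; rewrite ?ltry// -EFinB ltry.
Qed.

(** The integral of [f] may be infinite, in which case the limit is 0; the extended exponential
    covers both cases. The approximations [h] are simple functions cut to growing boxes and increase
    to [f]. *)
Lemma poisson_functional (f : plane R -> R) : measurable_fun setT f ->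
  (forall z, 0 <= f z <= 1) ->
  (\int[m]_w (\prod_(i < N) (1 - f (X i w)))%:E)%E @[N --> \oo] -->
  expeR (- (lam%:E * \int[mu2]_z (f z)%:E))%E.
Proof.
move=> mf f01.
have mf' : measurable_fun setT (EFin \o f) by exact/measurable_EFinP.
have f0 z : (0 <= (EFin \o f) z)%E by rewrite lee_fin; have /andP[] := f01 z.
pose g := nnsfun_approx measurableT mf'.
pose h k z := g k z * \1_(box k) z.
have gf k z : g k z <= f z.
  by rewrite -lee_fin /g nnsfun_approxE; apply: le_approx.
have g1 k z : g k z <= 1.
  by rewrite (le_trans (gf k z))//; have /andP[] := f01 z.
have hf k z : h k z <= f z.
  by rewrite (le_trans _ (gf k z))// ler_piMr.
have h01 k z : 0 <= h k z <= 1.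
  by rewrite /h mulr_ge0//= (le_trans (hf k z))//; have /andP[] := f01 z.
have ndh z : {homo (fun k => h k z) : k l / (k <= l)%N >-> k <= l}.
  move=> k l kl; apply: ler_pM => //.
  - exact/lefP/nd_nnsfun_approx.
  - rewrite !indicE ler_nat; case: (boolP (z \in box k)) => // zk.
    rewrite mem_set//; move/set_mem: zk => [/=]; rewrite !in_itv/=.
    have kl' : k%:R <= l%:R :> R by rewrite ler_nat.
    by move=> /andP[? ?] /andP[? ?]; split; rewrite /= in_itv/=; apply/andP; split; lra.
have hcvg z : h k z @[k --> \oo] --> f z.
  rewrite -[f z]mulr1; apply: cvgM.
    have : (g k z)%:E @[k --> \oo] --> (f z)%:E.
      by apply: (@cvg_nnsfun_approx _ _ _ setT _ _ mf').
    by move/fine_cvgP => [].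
  apply: cvg_near_cst; exists (Num.truncn (Num.max `|z.1 : R| `|z.2 : R|)).+1 => //= k /= kz.
  have : Num.max `|z.1 : R| `|z.2 : R| <= k%:R.
    by apply: ltW; apply: lt_le_trans (truncnS_gt _) _; rewrite ler_nat.
  rewrite ge_max => /andP[]; rewrite !ler_norml => z1 z2.
  by rewrite indicE mem_set//; split => /=; rewrite in_itv.
have mh k : measurable_fun setT (h k).
  by apply: measurable_funM => //; exact: measurable_indic.
(* [a] is nonincreasing in both arguments, so that its two limits commute. *)
pose a N k := (\int[m]_w (\prod_(i < N) (1 - h k (X i w)))%:E)%E.
pose a' N := (\int[m]_w (\prod_(i < N) (1 - f (X i w)))%:E)%E.
pose b k := expeR (- (lam%:E * \int[mu2]_z (h k z)%:E))%E.
have prod_anti (u v : plane R -> R) N w : (forall z, u z <= v z) ->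
    (forall z, 0 <= v z <= 1) ->
    \prod_(i < N) (1 - v (X i w)) <= \prod_(i < N) (1 - u (X i w)).
  move=> uv v01; apply: ler_prod => i _.
  by rewrite subr_ge0 lerB// andbT; have /andP[] := v01 (X i w).
have prod_ge0 (u : plane R -> R) N w : (forall z, 0 <= u z <= 1) ->
    0 <= \prod_(i < N) (1 - u (X i w)).
  by move=> u01; apply: prodr_ge0 => i _; rewrite subr_ge0; have /andP[] := u01 (X i w).
have prod_dec (u : plane R -> R) w : (forall z, 0 <= u z <= 1) ->
    {homo (fun N => \prod_(i < N) (1 - u (X i w))) : M N / (M <= N)%N >-> N <= M}.
  move=> u01; apply/nonincreasing_seqP => N; rewrite big_ord_recr/=.
  by rewrite ler_piMr ?prod_ge0// gerBl; have /andP[] := u01 (X N w).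
have ab k : a N k @[N --> \oo] --> b k by exact: poisson_functional_nnsfun.
have a'a N k : (a' N <= a N k)%E.
  apply: ge0_le_integral => //.
  - by move=> w _; rewrite lee_fin prod_ge0.
  - exact: mprodX.
  - exact: mprodX.
  - by move=> w _; rewrite lee_fin prod_anti.
have a_dec k : {homo a^~ k : M N / (M <= N)%N >-> (N <= M)%E}.
  move=> M N MN; apply: ge0_le_integral => //.
  - by move=> w _; rewrite lee_fin prod_ge0.
  - exact: mprodX.
  - exact: mprodX.
  - by move=> w _; rewrite lee_fin prod_dec.
have a'_dec : {homo a' : M N / (M <= N)%N >-> (N <= M)%E}.
  move=> M N MN; apply: ge0_le_integral => //.
  - by move=> w _; rewrite lee_fin prod_ge0.
  - exact: mprodX.
  - exact: mprodX.
  - by move=> w _; rewrite lee_fin prod_dec.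
have aa' N : a N k @[k --> \oo] --> a' N.
  have [] // := @dominated_convergence _ _ _ m setT measurableT
    (fun k w => (\prod_(i < N) (1 - h k (X i w)))%:E)
    (fun w => (\prod_(i < N) (1 - f (X i w)))%:E) (cst 1%E).
  - by move=> k; exact: mprodX.
  - exact: mprodX.
  - apply: aeW => w _.
    have hX : \prod_(i < N) (1 - h k (X i w)) @[k --> \oo] -->
        \prod_(i < N) (1 - f (X i w)).
      apply: cvg_big; first exact: mul_continuous.
      by move=> i _; apply: cvgB => //; exact: cvg_cst.
    by apply: cvg_EFin => //; exact: nearW.
  - apply: aeW => w k _; rewrite lee_fin ger0_norm ?prod_ge0//.
    apply: prodr_ile1 => i _; have /andP[? ?] := h01 k (X i w).
    by rewrite subr_ge0 gerBl; apply/andP.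
pose I0 := (\int[mu2]_z (f z)%:E)%E.
have I0_ge0 : (0 <= I0)%E by apply: integral_ge0 => z _; exact: f0.
have Icvg : (lam%:E * \int[mu2]_z (h k z)%:E)%E @[k --> \oo] --> (lam%:E * I0)%E.
  apply: cvgeZl => //.
  rewrite (_ : I0 = \int[mu2]_z limn (fun k => (h k z)%:E))%E; last first.
    apply: eq_integral => z _; apply/esym/cvg_lim => //.
    by apply: cvg_EFin; [exact: nearW|exact: hcvg].
  apply: cvg_monotone_convergence => //.
  - by move=> k; exact/measurable_EFinP.
  - by move=> k z _; rewrite lee_fin; have /andP[] := h01 k z.
  - by move=> z _ k l kl; rewrite lee_fin ndh.
have bb k : (expeR (- (lam%:E * I0)) <= b k)%E.
  rewrite lee_expeR leeN2 lee_wpmul2l ?lee_fin ?(ltW lam0)//.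
  apply: ge0_le_integral => //.
  - by move=> z _; rewrite lee_fin; have /andP[] := h01 k z.
  - exact/measurable_EFinP.
  - by move=> z _; rewrite lee_fin.
have cva' := ereal_nonincreasing_cvgn a'_dec.
rewrite (_ : expeR _ = ereal_inf (range a'))//; apply/eqP; rewrite eq_le; apply/andP; split.
(* For fixed N, the exponential is at most [b k], which is at most [a N k]; then k tends to
   infinity. *)
- apply: le_ereal_inf_tmp => _ [N _ <-].
  apply: cvge_ge (aa' N); apply: nearW => k.
  apply: (le_trans (bb k)).
  apply: cvge_le (ab k); exists N => // M /= NM; exact: a_dec.
- set l := ereal_inf _; have l0 : (0 <= l)%E.
    apply: le_ereal_inf_tmp => _ [N _ <-]; apply: integral_ge0 => w _.
    by rewrite lee_fin prod_ge0.
  have lb k : (l <= b k)%E.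
    apply: cvge_ge (ab k); apply: nearW => N.
    by apply: (le_trans _ (a'a N k)); apply: ereal_inf_lbound; exists N.
  (* Writing the infimum as an exponential, with y = -oo if it is 0, moves the comparison with all
     [b k] into the exponents, where the integrals converge. *)
  have [y yl] := expeR_total l0.
  rewrite -yl lee_expeR leeNr.
  apply: cvge_le Icvg; apply: nearW => k.
  by rewrite -leeNr -lee_expeR yl; exact: lb.
Qed.
End poisson_functional.

(** * Exclusion radii and link types *)

Lemma polar_direction (R : realType) (z : plane R) :
  polar (enorm2 z) (direction z) = z.
Proof.
case: z => x y; rewrite /polar /direction /enorm2/=.
set rho := Num.sqrt _.
have [r0|rneq0] := eqVneq rho 0.
  have : (x : R) ^+ 2 + (y : R) ^+ 2 <= 0 by rewrite -sqrtr_eq0 -/rho r0.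
  rewrite le_eqVlt ltNge addr_ge0 ?sqr_ge0// orbF paddr_eq0 ?sqr_ge0//.
  by rewrite !sqrf_eq0 => /andP[/eqP -> /eqP ->]; rewrite r0 !mul0r.
have rgt0 : 0 < rho by rewrite lt_neqAle eq_sym rneq0 sqrtr_ge0.
have r2 : rho ^+ 2 = x ^+ 2 + y ^+ 2 by rewrite sqr_sqrtr// addr_ge0 ?sqr_ge0.
have xr : -1 <= x / rho <= 1.
  rewrite -ler_norml normrM normfV (gtr0_norm rgt0) ler_pdivrMr// mul1r.
  by rewrite -sqrtr_sqr ler_sqrt ?addr_ge0 ?sqr_ge0// lerDl sqr_ge0.
have sinE : rho * sin (acos (x / rho)) = `|y : R|.
  rewrite sin_acos//.
  rewrite (_ : 1 - (x / rho) ^+ 2 = (y / rho) ^+ 2); last first.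
    by rewrite !expr_div_n r2; field; rewrite -r2 expf_neq0.
  by rewrite sqrtr_sqr normrM normfV (gtr0_norm rgt0) mulrC divfK.
have cosE : rho * cos (acos (x / rho)) = x.
  by rewrite acosK ?in_itv//= mulrC divfK.
case: ifPn => y0; first by rewrite cosE sinE ger0_norm.
rewrite cosB sinB mulr_natl cos2pi sin2pi !mul0r !mul1r addr0 sub0r cosE mulrN sinE.
by rewrite ltr0_norm ?ltNge// opprK.
Qed.

Lemma enorm2_polar (R : realType) (t theta : R) : 0 <= t ->
  enorm2 (polar t theta) = t.
Proof.
move=> t0; rewrite /enorm2 /polar/= !exprMn -mulrDr cos2Dsin2 mulr1.
by rewrite sqrtr_sqr ger0_norm.
Qed.

Lemma enorm2_ge0 (R : realType) (z : plane R) : 0 <= enorm2 z.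
Proof. exact: sqrtr_ge0. Qed.

Lemma measurable_sqrt (R : realType) : measurable_fun setT (@Num.sqrt R).
Proof. by apply: nondecreasing_measurable => // x y; exact: ler_wsqrtr. Qed.

Lemma measurable_enorm2 (R : realType) : measurable_fun setT (@enorm2 R).
Proof.
apply: (@measurableT_comp _ _ _ _ _ _ (@Num.sqrt R)).
  exact: measurable_sqrt.
by apply: measurable_funD; apply: measurable_funX.
Qed.

Section exclusion.
Context (R : realType) (ell : link_type -> R -> R) (hell : path_loss ell).

(** The set under the infimum is closed upwards because [ell v] is nonincreasing, so a witness below
    y can be raised to a rational one. This makes the comparison a countable condition. *)
Lemma excl_ltP v s (x y : R) : v <> s ->
  (excl ell v s x < y%:E)%E <->
  exists q : rat, [/\ 0 <= (ratr q : R), (ratr q : R) < y & ell v (ratr q) <= ell s x].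
Proof.
move=> vs; have -> : excl ell v s x =
    ereal_inf [set y%:E | y in [set y : R | 0 <= y /\ ell v y <= ell s x]].
  by case: v s vs => -[].
split=> [/ereal_inf_lt[_ [t [t0 tx] <-]]|[q [q0 qy qx]]].
- rewrite lte_fin => ty.
  have [q] := rat_in_itvoo ty; rewrite in_itv/= => /andP[tq qy].
  exists q; split => //; first by rewrite (le_trans t0)// ltW.
  by apply: le_trans tx; apply: (pl_noninc hell) => //; exact: ltW.
- apply: (@le_lt_trans _ _ (ratr q)%:E); last by rewrite lte_fin.
  by apply: ereal_inf_lbound; exists (ratr q).
Qed.

Lemma measurable_excl_lt d (T : measurableType d) v s (u y : T -> R) :
  measurable_fun setT u -> measurable_fun setT y -> (forall w, 0 <= u w) ->
  measurable [set w | (excl ell v s (u w) < (y w)%:E)%E].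
Proof.
move=> mu my u0.
have [<-|vs] := pselect (v = s).
  rewrite (_ : [set _ | _] = [set w | u w < y w]).
    by rewrite -[X in measurable X]setTI; exact: measurable_fun_ltr.
  by apply/seteqP; split => w; case: v => /=; rewrite lte_fin.
(* Monotonicity of [ell] is known on nonnegative arguments only; clipping extends it to the whole
   line, where it yields measurability. *)
pose e (x : R) := ell s (Num.max 0 x).
have me : measurable_fun setT (fun w => e (u w)).
  apply: (@measurableT_comp _ _ _ _ _ _ e) => //.
  apply: nonincreasing_measurable => // a b ab; apply: (pl_noninc hell).
    by rewrite le_max lexx.
  by rewrite ge_max !le_max lexx ab orbT.
rewrite (_ : [set _ | _] = \bigcup_(q in [set: rat])
    (if 0 <= (ratr q : R) then [set w | (ratr q : R) < y w] `&`
        [set w | ell v (ratr q) <= e (u w)] else set0)).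
  apply: bigcupT_measurable_rat => q; case: ifP => // _; apply: measurableI.
    by rewrite -[X in measurable X]setTI; exact: (measurable_fun_ltr (f := cst _)).
  by rewrite -[X in measurable X]setTI; exact: (measurable_fun_ler (f := cst _)).
have eu w : e (u w) = ell s (u w) by rewrite /e max_r.
apply/seteqP; split => w /=.
- by move=> /excl_ltP-/(_ vs)[q [q0 qy qx]]; exists q => //; rewrite q0; split => //=; rewrite eu.
- move=> [q _]; case: ifP => // q0 [/= qy]; rewrite eu => qx.
  by apply/excl_ltP => //; exists q.
Qed.

End exclusion.

Section links.
Context (R : realType) (d : measure_display) (Om : measurableType d).
Variables (P : probability Om R).
Variables (C : nat -> Om -> plane R) (len phi : nat -> Om -> measurableTypeR R).
Hypotheses (mC : forall i, measurable_fun setT (C i))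
  (mlen : forall i, measurable_fun setT (len i))
  (mphi : forall i, measurable_fun setT (phi i)).

(** Measurability jointly in the far end and the outcome is what makes the probabilities of the
    sections measurable in the far end. *)
Lemma measurable_link_has_type v :
  measurable [set zw : plane R * Om | link_has_type C len phi v zw.1 zw.2].
Proof.
have mb : measurable [set zw : plane R * Om | blocked C len phi zw.1 zw.2].
  rewrite (_ : [set _ | _] = \bigcup_i [set zw : plane R * Om |
      blockage (C i zw.2) (len i zw.2) (phi i zw.2) `&` link zw.1 !=set0]).
    apply: bigcup_measurable => i _; apply: measurable_segments_meet => //;
    by apply: measurableT_comp.
  by apply/seteqP; split => -[z w] /=; [move=> [i ?]|move=> [i _ ?]]; exists i.
case: v => //=; rewrite (_ : [set _ | _] = ~` [set zw : plane R * Om | blocked C len phi zw.1 zw.2])//.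
exact: measurableC.
Qed.

(** The joint probability in terms of the far ends of the links instead of lengths and angle, hence
    a section measure with z as the variable. *)
Definition link_pair_prob (s v : link_type) (y z : plane R) : R :=
  fine (P [set w | link_has_type C len phi s y w /\ link_has_type C len phi v z w]).

Lemma joint_link_probE s v r (z : plane R) :
  joint_link_prob P C len phi s v r (enorm2 z) (direction z) =
  link_pair_prob s v (polar r 0) z.
Proof. by rewrite /joint_link_prob polar_direction. Qed.

Lemma measurable_link_has_typeX v z :
  measurable [set w | link_has_type C len phi v z w].
Proof.
have := measurable_xsection z (measurable_link_has_type v).
by congr measurable; apply/seteqP; split => w; rewrite /xsection/= ?inE//=; rewrite inE.
Qed.

Lemma measurable_link_pair_prob s v y :
  measurable_fun setT (link_pair_prob s v y).
Proof.
apply: (@measurableT_comp _ _ _ _ _ _ (@fine R)) => //.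
pose A := [set zw : plane R * Om | link_has_type C len phi s y zw.2] `&`
  [set zw : plane R * Om | link_has_type C len phi v zw.1 zw.2].
have mA : measurable A.
  apply: measurableI; last exact: measurable_link_has_type.
  have := measurableX (@measurableT _ (plane R)) (measurable_link_has_typeX s y).
  by congr measurable; apply/seteqP; split => -[z w] //= [].
have := measurable_fun_xsection P mA.
by congr (measurable_fun _ _); apply/funext => z /=; congr (P _);
  apply/seteqP; split => w; rewrite /xsection/= inE.
Qed.

Lemma link_pair_prob_ge0 s v y z : 0 <= link_pair_prob s v y z.
Proof. exact: fine_ge0. Qed.

Lemma link_pair_prob_sum s y z :
  link_pair_prob s LoS y z + link_pair_prob s NLoS y z =
  fine (P [set w | link_has_type C len phi s y w]).
Proof.
rewrite /link_pair_prob.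
have mS v := measurable_link_has_typeX v.
have mI v : measurable [set w | link_has_type C len phi s y w /\ link_has_type C len phi v z w].
  by apply: (measurableI _ _ (mS s y) (mS v z)).
rewrite -fineD ?fin_num_measure// -measureU//; last first.
  by apply/seteqP; split => // w [[_ /= ?] [_ /= ?]].
congr (fine (P _)); apply/seteqP; split => w /=.
- by case=> -[].
- by move=> sy; have [b|b] := pselect (blocked C len phi z w); [right|left].
Qed.

End links.

(** * The given base station *)

Lemma ge0_integral_disc (R : realType) (e : \bar R) (q : plane R -> R) :
  measurable_fun setT q -> (forall z, 0 <= q z) ->
  (\int[@lebesgue_measure R \x @lebesgue_measure R]_z
     (q z * \1_[set z | ((enorm2 z)%:E <= e)%E] z)%:E =
   disc_integral e (fun t theta => q (polar t theta)))%E.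
Proof.
move=> mq q0.
have mA : measurable [set z : plane R | ((enorm2 z)%:E <= e)%E].
  rewrite -[X in measurable X]setTI.
  apply: emeasurable_fun_infty_c => //.
  by apply/measurable_EFinP; exact: measurable_enorm2.
rewrite ge0_integral_polar; last 2 first.
- by apply/measurable_EFinP/measurable_funM => //; exact: measurable_indic.
- by move=> z; rewrite lee_fin mulr_ge0.
apply: eq_integral => theta _; rewrite integral_mkcond [RHS]integral_mkcond.
apply: eq_integral => t _; rewrite !patchE mem_setE in_itv/= andbT indicE.
have [t0|t0] := ltP 0 t.
- have -> : (t \in [set t : R | 0 <= t /\ (t%:E <= e)%E]) =
      (polar t theta \in [set z : plane R | ((enorm2 z)%:E <= e)%E]).
    apply/idP/idP => /set_mem /= h; apply/mem_set => /=.
      by rewrite enorm2_polar ?(ltW t0)//; case: h.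
    by rewrite enorm2_polar ?(ltW t0)// in h; split => //; exact: ltW.
  by case: ifP => _; rewrite ?mulr1 ?mulr0 ?mul0e// EFinM.
(* The disc integral includes t = 0, where its weight t vanishes. *)
- case: ifPn => // /set_mem[/= t0' _].
  by rewrite (_ : t = 0) ?mulr0//; apply/eqP; rewrite eq_le t0.
Qed.

(** Ensures that the type of the given station can be conditioned on; for [NLoS] this requires a
    positive blockage rate. *)
Lemma link_prob_gt0 (R : realType) (mu : R)
    (nu : probability (measurableTypeR R) R) s r :
  0 < mu -> (0 < mean_length nu < +oo)%E -> 0 < r ->
  0 < link_prob (blockage_rate mu nu) s r.
Proof.
move=> mu0 nu0 r0; case: s => /=; first exact: expR_gt0.
rewrite subr_gt0 expR_lt1 oppr_lt0 mulr_gt0// /blockage_rate.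
by rewrite divr_gt0 ?pi_gt0// mulr_gt0 ?fine_gt0// mulr_gt0.
Qed.

Section given_base_station.
Context (R : realType) (lam : R) (lam0 : 0 < lam).
Context (db : measure_display) (Ob : measurableType db) (Pb : probability Ob R).
Context (C : nat -> Ob -> plane R) (len phi : nat -> Ob -> measurableTypeR R).
Hypotheses (mC : forall i, measurable_fun setT (C i))
  (mlen : forall i, measurable_fun setT (len i))
  (mphi : forall i, measurable_fun setT (phi i)).
Context (ell : link_type -> R -> R) (hell : path_loss ell).
Context (dq : measure_display) (Oq : measurableType dq)
  (Q : R -> probability Oq R).
Context (S0 : Oq -> link_type) (X : nat -> Oq -> plane R)
  (T : nat -> Oq -> link_type) (p : link_type -> R -> R).
Hypothesis hQ :
  first_order_law lam p (joint_link_prob Pb C len phi) Q S0 X T.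
Context (r : R) (r0 : 0 < r) (s : link_type) (ps0 : 0 < p s r).

Local Notation E := [set w | S0 w = s].
Local Notation J v z := (link_pair_prob Pb C len phi s v (polar r 0) z / p s r).

Let mE : measurable E. Proof. exact: (fo_S0_meas hQ s). Qed.

Let QE : Q r E = (p s r)%:E. Proof. exact: (fo_given hQ s r0). Qed.

Let pV0 : 0 <= (p s r)^-1. Proof. by rewrite invr_ge0 ltW. Qed.

(** The conditional law given S0 = s. As a scaled restriction of [Q r] it carries the measure
    structure that integration requires, unlike the bare set function [cond_prob], with which it
    agrees. *)
Let cond : {measure set Oq -> \bar R} := mscale (NngNum pV0) (mrestr (Q r) mE).

Let poisson_cond : poisson_process cond lam X.
Proof.
have := fo_others hQ s r0; rewrite (_ : cond_prob _ _ = cond)//.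
by apply/funext => A; rewrite /cond_prob QE.
Qed.

Let mX i : measurable_fun setT (X i). Proof. exact: poisson_cond.1. Qed.

Let integral_cond (f : Oq -> \bar R) : measurable_fun setT f ->
  (forall w, 0 <= f w)%E ->
  (\int[Q r]_(w in E) f w = (p s r)%:E * \int[cond]_w f w)%E.
Proof.
move=> mf f0.
rewrite ge0_integral_mscale//= (@ge0_integral_density _ _ _ _ _ (Q r) _ id (\1_E : Oq -> R))//; last first.
  move=> A mA; rewrite preimage_id integral_indic// setIC /= /mrestr setIC.
  by rewrite setIC.
rewrite muleA -EFinM divff ?gt_eqF// mul1e [LHS]integral_mkcond.
apply: eq_integral => w _; rewrite patchE indicE.
by case: ifP => _; rewrite ?mule1 ?mule0.
Qed.

(** Types are coded by booleans so that the type assignments of N stations form a finite type to sum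
    over. *)
Let lt (b : bool) := if b then LoS else NLoS.

Let J_ge0 v z : 0 <= J v z.
Proof. by rewrite divr_ge0 ?link_pair_prob_ge0// ltW. Qed.

Let mJ v : measurable_fun setT (fun z => J v z).
Proof.
by apply: measurable_funM => //; exact: measurable_link_pair_prob.
Qed.

Let fo_typesE (n : nat) (v : 'I_n -> link_type) (B : 'I_n -> set (plane R)) :
  (forall i, measurable (B i)) ->
  Q r [set w | S0 w = s /\ forall i : 'I_n, T i w = v i /\ B i (X i w)] =
  (\int[Q r]_(w in E)
     (\prod_(i < n) (\1_(B i) (X i w) * J (v i) (X i w)))%:E)%E.
Proof.
move=> mB; rewrite (fo_types hQ s r0 v mB); apply: eq_integral => w _.
by congr (_%:E); apply: eq_bigr => i _; rewrite joint_link_probE.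
Qed.

(* The sum does not depend on z, so that the case n = 1 of [fo_types] gives its value. *)
Let J_sum z : J LoS z + J NLoS z = 1.
Proof.
pose K := fine (Pb [set w | link_has_type C len phi s (polar r 0) w]).
have JK y : J LoS y + J NLoS y = K / p s r by rewrite -mulrDl link_pair_prob_sum.
have QT v : Q r [set w | S0 w = s /\ T 0%N w = v] = (\int[Q r]_(w in E) (J v (X 0%N w))%:E)%E.
  transitivity (Q r [set w | S0 w = s /\ forall i : 'I_1, T i w = v /\ setT (X i w)]).
    congr (Q r _); apply/seteqP; split => w /= [sw h]; split => //.
      by move=> i; rewrite ord1.
    by have [] := h ord0.
  rewrite (fo_typesE (fun=> v) (B := fun=> setT))//.
  by apply: eq_integral => w _; rewrite big_ord1 indicT mul1r.
have mQT v : measurable [set w | S0 w = s /\ T 0%N w = v].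
  by apply: measurableI => //; exact: (fo_T_meas hQ).
have mJX v : measurable_fun setT (fun w => (J v (X 0%N w))%:E).
  apply/measurable_EFinP.
  by apply: (@measurableT_comp _ _ _ _ _ _ (fun z => J v z)) => //; exact: mJ.
have : Q r E = (\int[Q r]_(w in E) (K / p s r)%:E)%E.
  transitivity (Q r [set w | S0 w = s /\ T 0%N w = LoS] + Q r [set w | S0 w = s /\ T 0%N w = NLoS])%E.
    rewrite -measureU//; last by apply/seteqP; split => // w [[_ /= ->] []].
    congr (Q r _); apply/seteqP; split => w /=; last by case=> -[].
    by move=> ->; case: (T 0%N w); [left|right].
  rewrite !QT -ge0_integralD//.
  - by apply: eq_integral => w _; rewrite -EFinD JK.
  - by move=> w _; rewrite lee_fin.
  - exact: measurable_funTS.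
  - by move=> w _; rewrite lee_fin.
  - exact: measurable_funTS.
rewrite integral_cst// [X in (_ * X)%E]QE QE -EFinM divfK ?gt_eqF// => -[ck].
by rewrite JK -ck divff// gt_eqF.
Qed.

Let B v : set (plane R) := [set z | (excl ell v s r < (enorm2 z)%:E)%E].

Let mB v : measurable (B v).
Proof.
by apply: measurable_excl_lt => //; [exact: measurable_enorm2|move=> _; exact: ltW].
Qed.

(** The conditional probability that a station at z prevents the given one from serving, averaged
    over the type of the former. *)
Let excluded (z : plane R) : R :=
  J LoS z * \1_[set z | ((enorm2 z)%:E <= excl ell LoS s r)%E] z +
  J NLoS z * \1_[set z | ((enorm2 z)%:E <= excl ell NLoS s r)%E] z.

Let excludedC z :
  1 - excluded z = \1_(B LoS) z * J LoS z + \1_(B NLoS) z * J NLoS z.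
Proof.
have indB v : \1_[set z | ((enorm2 z)%:E <= excl ell v s r)%E] z = 1 - \1_(B v) z :> R.
  rewrite (_ : [set _ | _] = ~` B v) ?indicC ?indicE; last first.
    by apply/seteqP; split => y /=; rewrite leNgt => /negP.
  by case: (z \in B v); rewrite /= ?subrr ?subr0.
have Jz := J_sum z; rewrite /excluded !indB.
(* The relation becomes 1 - (a + b) = 0, and adding this zero to the right-hand side leaves a ring
   identity. *)
move: (J LoS z) (J NLoS z) Jz => a b /(congr1 (fun x => 1 - x)).
by rewrite subrr => ab; rewrite -[RHS]addr0 -ab; ring.
Qed.

Let excluded01 z : 0 <= excluded z <= 1.
Proof.
apply/andP; split; first by apply: addr_ge0; rewrite mulr_ge0 ?J_ge0.
by rewrite -(J_sum z) lerD// ler_piMr ?J_ge0.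
Qed.

Let measurable_excluded_by v : measurable_fun setT (fun z =>
  J v z * \1_[set z | ((enorm2 z)%:E <= excl ell v s r)%E] z).
Proof.
apply: measurable_funM; first exact: mJ; apply: measurable_indic.
rewrite -[X in measurable X]setTI; apply: emeasurable_fun_infty_c => //.
by apply/measurable_EFinP; exact: measurable_enorm2.
Qed.

Let measurable_excluded : measurable_fun setT excluded.
Proof. by apply: measurable_funD; exact: measurable_excluded_by. Qed.

(** Blocking is meant here in the sense of association, by one of the first N other stations, not by
    a blockage. These events decrease to the serving event. *)
Let not_blocked_by N : set Oq :=
  [set w | S0 w = s /\ forall i : 'I_N, B (T i w) (X i w)].

Let mEN N : measurable (not_blocked_by N).
Proof.
rewrite (_ : not_blocked_by N = E `&` \big[setI/setT]_(i < N)
    ([set w | T i w = LoS] `&` (X i @^-1` B LoS) `|`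
     [set w | T i w = NLoS] `&` (X i @^-1` B NLoS))).
  apply: measurableI => //; apply: bigsetI_measurable => i _.
  have mXB v : measurable (X i @^-1` B v).
    by rewrite -[Y in measurable Y]setTI; apply: mX.
  by apply: measurableU; apply: measurableI => //; exact: (fo_T_meas hQ).
rewrite -bigcap_seq; apply/seteqP; split => w /= [sw h]; split => //.
- by move=> i _ /=; have := h i; case: (T i w); [left|right].
- by move=> i; have := h i (mem_index_enum i); case=> /= -[-> ].
Qed.

(** The event is split according to the types of the first N stations. [fo_types] gives each piece
    as the integral of a product, and distributivity turns the sum over assignments into a product
    of two-term sums, each equal to 1 - [excluded]. *)
Let prob_not_blocked_by N : Q r (not_blocked_by N) =
  (\int[Q r]_(w in E) (\prod_(i < N) (1 - excluded (X i w)))%:E)%E.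
Proof.
pose F (b : {ffun 'I_N -> bool}) :=
  [set w | S0 w = s /\ forall i : 'I_N, T i w = lt (b i) /\ B (lt (b i)) (X i w)].
have mF b : measurable (F b).
  rewrite (_ : F b = E `&` \big[setI/setT]_(i < N)
      ([set w | T i w = lt (b i)] `&` (X i @^-1` B (lt (b i))))).
    apply: measurableI => //; apply: bigsetI_measurable => i _.
    apply: measurableI; first exact: (fo_T_meas hQ).
    by rewrite -[Y in measurable Y]setTI; apply: mX.
  rewrite -bigcap_seq; apply/seteqP; split => w /= [sw h]; split => //.
    by move=> i _ /=; exact: h.
  by move=> i; have := h i (mem_index_enum i).
have indE w : \1_(not_blocked_by N) w = \sum_b \1_(F b) w :> R.
  pose b0 : {ffun 'I_N -> bool} := [ffun i : 'I_N => if T i w is LoS then true else false].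
  have b0P (i : 'I_N) : T i w = lt (b0 i) by rewrite ffunE; case: (T i w).
  rewrite (bigD1 b0)//= [X in _ + X]big1 ?addr0; last first.
    move=> b bb0; rewrite indicE memNset// => -[_ /= h].
    move/eqP : bb0; apply; apply/ffunP => i.
    by have [] := h i; rewrite b0P; case: (b i); case: (b0 i).
  rewrite !indicE; congr (_%:R); congr (nat_of_bool _).
  apply/idP/idP => /set_mem[sw h]; apply/mem_set; split => // i.
    by split; [exact: b0P|rewrite -b0P; exact: h].
  by have [-> ] := h i.
have -> : Q r (not_blocked_by N) = (\int[Q r]_w (\1_(not_blocked_by N) w)%:E)%E.
  by rewrite integral_indic ?setIT//; exact: mEN.
under eq_integral do rewrite indE -sumEFin.
rewrite ge0_integral_sum//; last first.
  by move=> b; apply/measurable_EFinP; exact: measurable_indic.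
transitivity (\sum_(b : {ffun 'I_N -> bool}) \int[Q r]_(w in E)
    (\prod_(i < N) (\1_(B (lt (b i))) (X i w) * J (lt (b i)) (X i w)))%:E)%E.
  apply: eq_bigr => b _; rewrite integral_indic// setIT.
  by rewrite -(fo_typesE (fun i => lt (b i)) (B := fun i => B (lt (b i)))).
have mprod (b : {ffun 'I_N -> bool}) : measurable_fun setT (fun w =>
    (\prod_(i < N) (\1_(B (lt (b i))) (X i w) * J (lt (b i)) (X i w)))%:E).
  apply/measurable_EFinP; apply: measurable_prod => i _; apply: measurable_funM.
    by apply: (@measurableT_comp _ _ _ _ _ _ (\1_(B (lt (b i))) : plane R -> R)).
  by apply: (@measurableT_comp _ _ _ _ _ _ (fun z => J (lt (b i)) z)) => //; exact: mJ.
rewrite -ge0_integral_sum//; last 2 first.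
- by move=> b; exact: measurable_funTS.
- by move=> b w _; rewrite lee_fin; apply: prodr_ge0 => i _; rewrite mulr_ge0 ?J_ge0.
apply: eq_integral => w _; rewrite sumEFin; congr (_%:E).
rewrite -(bigA_distr_bigA (fun (i : 'I_N) (b : bool) =>
  \1_(B (lt b)) (X i w) * J (lt b) (X i w))).
by apply: eq_bigr => i _; rewrite big_bool excludedC.
Qed.

(** Continuity from above and the generating functional give two limits for the same sequence of
    probabilities. Since [excl] reduces to the distance itself for equal types, the two choices of
    [s] are exactly [g_LoS] and [g_NLoS]. *)
Lemma given_serving_prob :
  (Q r (given_serving ell S0 X T s r) = (p s r)%:E * expeR
    (- (lam%:E * disc_integral (excl ell LoS s r)
          (fun t theta => (joint_link_prob Pb C len phi s LoS r t theta / p s r)%R))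
     - lam%:E * disc_integral (excl ell NLoS s r)
          (fun t theta => (joint_link_prob Pb C len phi s NLoS r t theta / p s r)%R)))%E.
Proof.
have nbcap : given_serving ell S0 X T s r = \bigcap_N not_blocked_by N.
  apply/seteqP; split => w /=.
    by move=> [sw h] N _; split => // i; exact: h.
  move=> h; have [sw _] := h 0%N Logic.I; split => // i.
  by have [_ /(_ ord_max)] := h i.+1 Logic.I.
have mcap : measurable (\bigcap_N not_blocked_by N) by exact: bigcap_measurable.
have decr : {homo not_blocked_by : M N / (M <= N)%N >-> (N <= M)%O}.
  move=> M N MN; apply/subsetPset => w /= [sw h]; split => // i.
  by have := h (widen_ord MN i).
have lim1 : Q r (not_blocked_by N) @[N --> \oo] --> Q r (\bigcap_N not_blocked_by N).
  apply: nonincreasing_cvg_mu => //.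
  exact: (le_lt_trans (probability_le1 _ _) (ltry _)).
have lim2 : Q r (not_blocked_by N) @[N --> \oo] -->
    ((p s r)%:E * expeR (- (lam%:E * \int[@lebesgue_measure R \x @lebesgue_measure R]_z (excluded z)%:E)))%E.
  rewrite (_ : (fun N => Q r (not_blocked_by N)) = fun N =>
      ((p s r)%:E * \int[cond]_w (\prod_(i < N) (1 - excluded (X i w)))%:E)%E); last first.
    apply/funext => N; rewrite prob_not_blocked_by integral_cond//.
      apply/measurable_EFinP; apply: measurable_prod => i _; apply: measurable_funB => //.
      by apply: (@measurableT_comp _ _ _ _ _ _ excluded).
    move=> w; rewrite lee_fin; apply: prodr_ge0 => i _; rewrite subr_ge0.
    by have /andP[] := excluded01 (X i w).
  by apply: cvgeZl => //; exact: poisson_functional.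
rewrite nbcap (cvg_unique _ lim1 lim2)//; congr (_ * expeR _)%E.
have discE v : (disc_integral (excl ell v s r)
    (fun t theta => (joint_link_prob Pb C len phi s v r t theta / p s r)%R) =
    \int[@lebesgue_measure R \x @lebesgue_measure R]_z
     (J v z * \1_[set z | ((enorm2 z)%:E <= excl ell v s r)%E] z)%R%:E)%E.
  by rewrite (@ge0_integral_disc R _ (fun z => J v z)).
rewrite !discE -oppeD; last first.
  rewrite ge0_adde_def// inE; apply: mule_ge0; rewrite ?lee_fin ?(ltW lam0)//;
  by apply: integral_ge0 => z _; rewrite lee_fin mulr_ge0 ?J_ge0.
congr (- _)%E; rewrite -ge0_muleDr; last 2 first.
- by apply: integral_ge0 => z _; rewrite lee_fin mulr_ge0 ?J_ge0.
- by apply: integral_ge0 => z _; rewrite lee_fin mulr_ge0 ?J_ge0.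
congr (_ * _)%E; rewrite -ge0_integralD//.
- by move=> z _; rewrite lee_fin mulr_ge0 ?J_ge0.
- by apply/measurable_EFinP; exact: measurable_excluded_by.
- by move=> z _; rewrite lee_fin mulr_ge0 ?J_ge0.
- by apply/measurable_EFinP; exact: measurable_excluded_by.
Qed.

End given_base_station.

(** * The typical user *)

(** Two serving stations of the same type would each be strictly farther away than the other. *)
Lemma serving_trivIset (R : realType) (Om : Type) (ell : link_type -> R -> R)
    (Y : nat -> Om -> plane R) (U : nat -> Om -> link_type) s :
  trivIset setT (serving ell Y U s).
Proof.
have exclss x : excl ell s s x = x%:E by case: s.
apply/trivIsetP => i j _ _ /eqP ij; apply/seteqP; split => // w [[Ui hi] [Uj hj]].
have := hi j (nesym ij); have := hj i ij.
rewrite Ui Uj !exclss !lte_fin => h1 h2.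
by have := lt_trans h1 h2; rewrite ltxx.
Qed.

Lemma measurable_serving (R : realType) (ell : link_type -> R -> R) d
    (Om : measurableType d) (Y : nat -> Om -> plane R)
    (U : nat -> Om -> link_type) s i : path_loss ell ->
  (forall i, measurable_fun setT (Y i)) ->
  (forall i v, measurable [set w | U i w = v]) ->
  measurable (serving ell Y U s i).
Proof.
move=> hell mY mU.
have mYn j : measurable_fun setT (fun w => enorm2 (Y j w)).
  by apply: (@measurableT_comp _ _ _ _ _ _ (@enorm2 R)) => //; exact: measurable_enorm2.
pose A v j := [set w | (excl ell v s (enorm2 (Y i w)) < (enorm2 (Y j w))%:E)%E].
have mA v j : measurable (A v j).
  by apply: measurable_excl_lt => // w; exact: enorm2_ge0.
rewrite (_ : serving ell Y U s i = [set w | U i w = s] `&`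
    \bigcap_(j in [set j | j <> i])
      ([set w | U j w = LoS] `&` A LoS j `|` [set w | U j w = NLoS] `&` A NLoS j)).
  apply: measurableI => //; apply: bigcap_measurable.
    by exists i.+1 => /= /esym /n_Sn.
  by move=> j _; apply: measurableU; exact: measurableI.
apply/seteqP; split => w /= [Ui h]; split => // j ji.
- by have := h j ji; case Uj : (U j w) => hj; [left|right].
- by have [[-> ]|[-> ]] := h j ji.
Qed.

Lemma associated_palm (R : realType) (lam : R) (ell : link_type -> R -> R)
    (hell : path_loss ell)
    (dq : measure_display) (Oq : measurableType dq) (Q : R -> probability Oq R)
    (S0 : Oq -> link_type) (X : nat -> Oq -> plane R) (T : nat -> Oq -> link_type)
    (da : measure_display) (Oa : measurableType da) (Pa : probability Oa R)
    (Y : nat -> Oa -> plane R) (U : nat -> Oa -> link_type) s :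
  bs_process Pa lam Y U -> first_order_palm Pa lam ell Y U Q S0 X T s ->
  Pa (associated ell Y U s) = G_serv lam ell Q S0 X T s 0.
Proof.
move=> hbs palm.
have mY i : measurable_fun setT (Y i) by exact: (bs_poisson hbs).1.
have mS i : measurable (serving ell Y U s i).
  by apply: measurable_serving => // j v; exact: (bs_types_meas hbs).
have mB : measurable (`[0, +oo[%classic : set (measurableTypeR R)) by [].
have mAs : measurable (associated ell Y U s) by exact: bigcup_measurable.
transitivity (\int[Pa]_w (\1_(associated ell Y U s) w)%:E)%E.
  by rewrite integral_indic// setIT.
transitivity (\int[Pa]_(w in setT) \sum_(0 <= i <oo)
    (\1_[set w' | serving ell Y U s i w' /\ (`[0, +oo[%classic : set R) (enorm2 (Y i w'))] w)%:E)%E.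
  apply: eq_integral => w _; rewrite indic_bigcup; last exact: serving_trivIset.
  apply: eq_eseriesr => i _; congr (\1__ _)%:E.
  apply/seteqP; split => w' /=; last by case.
  by move=> ?; split => //; rewrite in_itv/= andbT enorm2_ge0.
rewrite (palm _ mB)// /G_serv; congr (_ * _)%E.
(* The Palm formula is used on [0, +oo[, whereas [G_serv] at 0 integrates over ]0, +oo[; at x = 0
   the factor x makes the integrand 0. *)
rewrite integral_mkcond [RHS]integral_mkcond; apply: eq_integral => x _.
rewrite !patchE !mem_setE !in_itv/= !andbT; case: ltgtP => // <-.
by rewrite mule0.
Qed.

Theorem lemma5 (R : realType) (lam mu : R) (hlam : 0 < lam) (hmu : 0 < mu)
  (nu : probability (measurableTypeR R) R)
  (* blockages *)
  (db : measure_display) (Ob : measurableType db) (Pb : probability Ob R)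
  (C : nat -> Ob -> plane R) (len phi : nat -> Ob -> measurableTypeR R)
  (hblock : boolean_model Pb mu nu C len phi)
  (* path loss *)
  (ell : link_type -> R -> R) (hell : path_loss ell)
  (* the laws Q_r *)
  (dq : measure_display) (Oq : measurableType dq) (Q : R -> probability Oq R)
  (S0 : Oq -> link_type) (X : nat -> Oq -> plane R) (T : nat -> Oq -> link_type)
  (hQ : first_order_law lam (link_prob (blockage_rate mu nu))
          (joint_link_prob Pb C len phi) Q S0 X T)
  (* the base stations and their types *)
  (da : measure_display) (Oa : measurableType da) (Pa : probability Oa R)
  (Y : nat -> Oa -> plane R) (U : nat -> Oa -> link_type)
  (hbs : bs_process Pa lam Y U) :
  let p := link_prob (blockage_rate mu nu) in
  let p2 := joint_link_prob Pb C len phi in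
  let A := fun s => Pa (associated ell Y U s) in
  let G := G_serv lam ell Q S0 X T in
  ((first_order_palm Pa lam ell Y U Q S0 X T LoS -> A LoS = G LoS 0) /\
   G LoS 0 = ((2 * pi * lam)%:E *
     \int[lebesgue_measure]_(x in `]0%R, +oo[) (g_LoS lam ell p p2 x * x%:E))%E)
  /\
  ((first_order_palm Pa lam ell Y U Q S0 X T NLoS -> A NLoS = G NLoS 0) /\
   G NLoS 0 = ((2 * pi * lam)%:E *
     \int[lebesgue_measure]_(x in `]0%R, +oo[) (g_NLoS lam ell p p2 x * x%:E))%E).
Proof.
move=> p p2 A G.
have mC : forall i, measurable_fun setT (C i) by exact: (bm_centers hblock).1.
have p0 s x : 0 < x -> 0 < p s x.
  move=> x0; apply: link_prob_gt0 => //.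
  by rewrite (bm_len_mean_gt0 hblock) (bm_len_mean_fin hblock).
have servE s x : 0 < x -> Q x (given_serving ell S0 X T s x) = _ := fun x0 =>
  given_serving_prob hlam mC (bm_len_meas hblock) (bm_phi_meas hblock) hell hQ x0 (p0 s x x0).
split; split; try (by move=> ?; exact: associated_palm).
- congr (_ * _)%E; apply: eq_integral => x; rewrite inE/= in_itv/= andbT => x0.
  by rewrite servE.
- congr (_ * _)%E; apply: eq_integral => x; rewrite inE/= in_itv/= andbT => x0.
  by rewrite servE.
Qed.
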